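(* Let $Q$ be a non-elementary, torsion free, lacunary hyperbolic group with property (T) all of whose maximal subgroups are isomorphic to a given nontrivial rank one group, and let $N\rtimes Q\in\mathcal{R}ip_T(Q)$. For every maximal (rank one) subgroup $Q_m<Q$ consider the subgroup $N\rtimes Q_m<N\rtimes Q$. Then $\mathcal L(N\rtimes Q_m)\subset\mathcal L(N\rtimes Q)$ is a maximal von Neumann subalgebra.
   Context: All groups are countable and discrete; $\mathcal L(G)$ is the group von Neumann algebra of $G$. A group is called rank one if it is isomorphic to a subgroup of $(\mathbb Q,+)$. A von Neumann subalgebra $\mathcal N\subset\mathcal M$ is maximal if there is no von Neumann algebra $\mathcal P$ with $\mathcal N\subsetneq\mathcal P\subsetneq\mathcal M$. A finitely generated group is lacunary hyperbolic if it is the direct limit of a sequence of epimorphisms $\eta_i:G_i\to G_{i+1}$ of hyperbolic groups, where $G_i$ is generated by a finite set $S_i$, $\eta_i(S_i)=S_{i+1}$, $G_i$ is $\delta_i$-hyperbolic with respect to $S_i$, and $\delta_i=o(r_{S_i}(\eta_i))$, where $r_{S_i}(\eta_i)$ is the largest radius of a ball centered at the identity in the Cayley graph of $G_i$ with respect to $S_i$ on which $\eta_i$ is injective. Elementary means virtually cyclic. For a finitely generated torsion free group $Q$, $\mathcal{R}ip(Q)$ denotes the class of all semidirect products $G=N\rtimes_\sigma Q$ such that: (1) $N$ is isomorphic to a quotient of some torsion free, non-elementary hyperbolic group with property (T); (2) $Q$ is a proper subgroup of $G$ and $G$ is hyperbolic relative to $\{Q\}$; (3) $G$ is torsion free; (4)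 the canonical map $Q\to\mathrm{Out}(N)$ is injective with finite index image. When $Q$ moreover has property (T), this class is denoted $\mathcal{R}ip_T(Q)$. *)

(* Defs.v *)
(* MathComp and MathComp-Analysis, over an arbitrary R : realType, with complex
   scalars R[i].  Groups are groupType's, finite or infinite. *)
From HB Require Import structures.
From mathcomp Require Import all_boot all_order all_algebra.
From mathcomp Require Import all_classical all_reals all_analysis.
From mathcomp Require Import complex sesquilinear.
From mathcomp Require Import ring lra.
Set Implicit Arguments.
Unset Strict Implicit.
Unset Printing Implicit Defensive.
Import Order.TTheory GRing.Theory Num.Theory.
Local Open Scope classical_set_scope.
Local Open Scope ring_scope.

Section Groups.
Implicit Types G H : groupType.

Definition subgroup G (H : set G) : Prop :=
  [/\ H 1%g, (forall x y, H x -> H y -> H (x * y)%g) &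
      forall x, H x -> H x^-1%g].

Definition generated G (S : set G) : set G := smallest (@subgroup G) S.

Definition generates G (S : set G) : Prop := generated S = [set: G].

Definition finitely_generated G : Prop :=
  exists2 S : set G, finite_set S & generates S.

Definition finite_index G (H : set G) : Prop :=
  exists2 T : set G, finite_set T &
    forall g, exists2 t, T t & H (t^-1 * g)%g.

(* Virtually cyclic; in particular finite groups are elementary. *)
Definition elementary G : Prop :=
  exists x : G, finite_index (generated [set x]).

Definition torsion_free G : Prop :=
  forall (x : G) (n : nat), (0 < n)%N -> (x ^+ n = 1)%g -> x = 1%g.

Definition nontrivial G : Prop := exists x : G, x <> 1%g.

Definition maximal_subgroup G (M : set G) : Prop :=
  [/\ subgroup M, M <> [set: G] &
      forall K : set G, subgroup K -> M `<=` K -> K = M \/ K = [set: G]].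

Definition subgroup_isomorphic G (H : set G) (A : groupType) : Prop :=
  exists2 f : {multiplicative A -> G}, injective f & range f = H.

Definition rank_one G : Prop :=
  exists2 f : G -> rat, injective f &
    forall x y, f (x * y)%g = f x + f y.

End Groups.

Section Graphs.
Context {R : realType} {V : Type} (e : V -> V -> Prop).

Definition walk (p : nat -> V) (n : nat) (x y : V) : Prop :=
  [/\ p 0%N = x, p n = y & forall i, (i < n)%N -> e (p i) (p i.+1)].

Definition geodesic (p : nat -> V) (n : nat) (x y : V) : Prop :=
  walk p n x y /\ forall q m, walk q m x y -> (n <= m)%N.

Definition within (r : R) (x y : V) : Prop :=
  exists p n, walk p n x y /\ n%:R <= r.

(* Slim triangles: each side of a geodesic triangle lies in the closed
   d-neighbourhood of the union of the other two.  Sides are the sequences of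
   vertices of edge paths.  Since the three vertices are arbitrary and paths in
   a symmetric graph can be reversed, it suffices to look at the side p.
   Allowing vertices and sides of triangles to meet the interior of edges, as
   in the geometric realization, changes d by at most an additive constant. *)
Definition hyperbolic_graph (d : R) : Prop :=
  forall (x y z : V) (p q r : nat -> V) (a b c : nat),
    geodesic p a x y -> geodesic q b y z -> geodesic r c x z ->
    forall i, (i <= a)%N ->
      (exists2 j, (j <= b)%N & within d (p i) (q j)) \/
      (exists2 j, (j <= c)%N & within d (p i) (r j)).

End Graphs.

Definition cayley (G : groupType) (S : set G) (x y : G) : Prop :=
  S (x^-1 * y)%g \/ S (y^-1 * x)%g.

Definition hyperbolic_group (R : realType) (G : groupType) : Prop :=
  exists2 S : set G, finite_set S /\ generates S &
    exists d : R, hyperbolic_graph (cayley S) d.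

Definition cayley_ball (R : realType) (G : groupType) (S : set G) (r : R) :
  set G := [set g | within (cayley S) r 1%g g].

(* The largest radius of a ball on which f is injective; it is +oo when f is
   injective on all of them. *)
Definition injectivity_radius (R : realType) (G H : groupType) (S : set G)
    (f : G -> H) : \bar R :=
  ereal_sup [set (n%:R : R)%:E |
    n in [set n : nat | set_inj (cayley_ball S (n%:R : R)) f]].

Section DirectLimit.
Variables (H : nat -> groupType)
  (eta : forall i, {multiplicative H i -> H i.+1}).

Fixpoint transition (i n : nat) : H i -> H (n + i) :=
  match n return H i -> H (n + i) with
  | 0 => fun x => x
  | n'.+1 => fun x => eta (n' + i) (transition n' x)
  end.

(* The standard direct limit of the H i, up to isomorphism: every element comes
   from a stage, and an element of a stage dies in G iff it dies at a later
   stage. *)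
Definition is_direct_limit (G : groupType) : Prop :=
  exists phi : forall i, {multiplicative H i -> G},
    [/\ forall i x, phi i.+1 (eta i x) = phi i x,
        forall g, exists i, exists x, phi i x = g &
        forall i x, phi i x = 1%g -> exists n, transition n x = 1%g].

End DirectLimit.

Definition lacunary_hyperbolic (R : realType) (G : groupType) : Prop :=
  finitely_generated G /\
  exists (H : nat -> groupType)
         (eta : forall i, {multiplicative H i -> H i.+1})
         (S : forall i, set (H i)) (delta : nat -> R),
    [/\ forall i, range (eta i) = [set: H i.+1],
        forall i, [/\ finite_set (S i), generates (S i) &
                      eta i @` S i = S i.+1],
        forall i, hyperbolic_graph (cayley (S i)) (delta i),
        forall eps : R, 0 < eps -> \forall i \near \oo,
          ((delta i)%:E <= eps%:E * injectivity_radius R (S i) (eta i))%E &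
        is_direct_limit eta G].

(* Osin's definition: G has a finite presentation relative to H whose relative
   Dehn function is bounded by a linear function. *)
Section RelativelyHyperbolic.
Variables (G : groupType) (H X : set G).

Definition letter : Type := ((X + H) * bool)%type.
Definition word : Type := seq letter.

Definition letter_inv (a : letter) : letter := (a.1, ~~ a.2).
Definition word_inv (w : word) : word := rev (map letter_inv w).

Definition letter_eval (a : letter) : G :=
  let g := match a.1 with inl x => val x | inr h => val h end in
  if a.2 then g else (g^-1)%g.
Definition word_eval (w : word) : G := (\prod_(a <- w) letter_eval a)%g.

(* Equality, in the free product of H and the free group on X, of the elements
   represented by two words. *)
Inductive free_product_eq : word -> word -> Prop :=
| fp_refl w : free_product_eq w w
| fp_sym v w : free_product_eq v w -> free_product_eq w v
| fp_trans u v w :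
    free_product_eq u v -> free_product_eq v w -> free_product_eq u w
| fp_cat v v' w w' : free_product_eq v v' -> free_product_eq w w' ->
    free_product_eq (v ++ w) (v' ++ w')
| fp_cancel a : free_product_eq [:: a; letter_inv a] [::]
| fp_mul (h k l : H) : val l = (val h * val k)%g ->
    free_product_eq [:: (inr h, true); (inr k, true)] [:: (inr l, true)].

(* The product of the words f^-1 r^(+1 or -1) f, over the entries (f, r, s). *)
Definition conjugates (ps : seq (word * word * bool)) : word :=
  flatten [seq word_inv p.1.1 ++
               (if p.2 then p.1.2 else word_inv p.1.2) ++ p.1.1 | p <- ps].

Definition linear_relative_presentation (rels : set word) (C : nat) : Prop :=
  [/\ generates (X `|` H),
      forall r, rels r -> word_eval r = 1%g &
      forall w : word, word_eval w = 1%g ->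
        exists ps : seq (word * word * bool),
          [/\ forall p, List.In p ps -> rels p.1.2,
              (size ps <= C * size w)%N &
              free_product_eq w (conjugates ps)]].

End RelativelyHyperbolic.

Definition relatively_hyperbolic (G : groupType) (H : set G) : Prop :=
  subgroup H /\
  exists X : set G, finite_set X /\
  exists rels : set (word H X), finite_set rels /\
  exists C : nat, linear_relative_presentation rels C.

Section HilbertSpace.
Context {R : realType} {V : lmodType R[i]}.
Variable dot : {dot V for Num.conj}.

Definition hnorm (v : V) : R := Num.sqrt (complex.Re (dot v v)).

Definition hilbert_complete : Prop :=
  forall u : nat -> V,
    (forall eps : R, 0 < eps -> exists N : nat, forall m n : nat,
      (N <= m)%N -> (N <= n)%N -> hnorm (u m - u n) < eps) ->
    exists l : V, forall eps : R, 0 < eps -> exists N : nat, forall n : nat,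
      (N <= n)%N -> hnorm (u n - l) < eps.

Definition unitary_representation (G : groupType) (rho : G -> {linear V -> V}) :
  Prop :=
  [/\ forall v, rho 1%g v = v,
      forall g h v, rho (g * h)%g v = rho g (rho h v) &
      forall g u v, dot (rho g u) (rho g v) = dot u v].

Definition bounded_operator (T : V -> V) : Prop :=
  linear T /\ exists C : R, forall v, hnorm (T v) <= C * hnorm v.

Definition adjoint_to (T S : V -> V) : Prop :=
  forall u v, dot (T u) v = dot u (S v).

Definition commutant (A : set (V -> V)) : set (V -> V) :=
  [set T | bounded_operator T /\ forall S, A S -> T \o S = S \o T].

(* By the bicommutant theorem these are, on a Hilbert space, the unital
   *-subalgebras of bounded operators closed in the weak operator topology. *)
Definition von_neumann_algebra (M : set (V -> V)) : Prop :=
  [/\ M `<=` bounded_operator,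
      forall T S, M T -> bounded_operator S -> adjoint_to T S -> M S &
      commutant (commutant M) = M].

Definition maximal_von_neumann_subalgebra (N M : set (V -> V)) : Prop :=
  [/\ von_neumann_algebra N, von_neumann_algebra M, N `<=` M &
      ~ exists P : set (V -> V),
          [/\ von_neumann_algebra P, N `<` P & P `<` M]].

End HilbertSpace.

(* For a discrete group: there is a Kazhdan pair (F, eps) with F finite. *)
Definition property_T (R : realType) (G : groupType) : Prop :=
  exists2 F : set G, finite_set F & exists2 eps : R, 0 < eps &
    forall (V : lmodType R[i]) (dot : {dot V for Num.conj})
           (rho : G -> {linear V -> V}),
      hilbert_complete dot -> unitary_representation dot rho ->
      (exists2 v : V, hnorm dot v = 1 &
         forall g, F g -> hnorm dot (rho g v - v) < eps) ->
      exists2 v : V, v <> 0 & forall g, rho g v = v.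

Record action (N Q : groupType) := Action {
  act :> Q -> N -> N;
  act1 : forall n, act 1%g n = n;
  actM : forall q r n, act (q * r)%g n = act q (act r n);
  act_mul : forall q m n, act q (m * n)%g = (act q m * act q n)%g }.

Section SemidirectProduct.
Context {N Q : groupType}.

Definition sdprod (sigma : action N Q) : Type := (N * Q)%type.

Variable sigma : action N Q.
Implicit Types x y z : sdprod sigma.

HB.instance Definition _ := Choice.on (sdprod sigma).

Let one : sdprod sigma := (1%g, 1%g).
Let mul x y : sdprod sigma := ((x.1 * sigma x.2 y.1)%g, (x.2 * y.2)%g).
Let inv x : sdprod sigma := (sigma (x.2^-1)%g (x.1^-1)%g, (x.2^-1)%g).

Let act_one q : sigma q 1%g = 1%g.
Proof.
have : (sigma q 1 * sigma q 1 = sigma q 1 * 1)%g by rewrite -act_mul !mulg1.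
exact: mulgI.
Qed.

Let mulA : associative mul.
Proof. by case=> [a q] [b r] [c s]; rewrite /mul /= act_mul actM !mulgA. Qed.

Let mul1 : left_id one mul.
Proof. by case=> [a q]; rewrite /mul /= act1 !mul1g. Qed.

Let mulr1 : right_id one mul.
Proof. by case=> [a q]; rewrite /mul /= act_one !mulg1. Qed.

Let mulVl : left_inverse one inv mul.
Proof.
by case=> [a q]; rewrite /mul /inv /= -act_mul !mulVg act_one.
Qed.

Let mulVr : right_inverse one inv mul.
Proof.
by case=> [a q]; rewrite /mul /inv /= -actM !mulgV act1 mulgV.
Qed.

HB.instance Definition _ :=
  isGroup.Build (sdprod sigma) mulA mul1 mulr1 mulVl mulVr.

Definition sdprod_over (K : set Q) : set (sdprod sigma) := [set x | K x.2].

Definition sdprod_right : set (sdprod sigma) := [set x | x.1 = 1%g].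

End SemidirectProduct.
Arguments sdprod_over {N Q} sigma K _.
Arguments sdprod_right {N Q} sigma _.

(* For automorphisms f and g: equality of their classes in
   Out(N) = Aut(N) / Inn(N).  This group is not built; the map from Q to it is
   described through representatives. *)
Definition outer_eq (N : groupType) (f g : N -> N) : Prop :=
  exists n : N, forall x, f x = g (n * x * n^-1)%g.

Definition automorphism (N : groupType) (f : N -> N) : Prop :=
  bijective f /\ forall x y, f (x * y)%g = (f x * f y)%g.

Definition Out_injective (N Q : groupType) (sigma : action N Q) : Prop :=
  forall q r, outer_eq (sigma q) (sigma r) -> q = r.

(* Finitely many left cosets of the image of Q cover Out(N). *)
Definition Out_finite_index_image (N Q : groupType) (sigma : action N Q) :
  Prop :=
  exists (k : nat) (f : 'I_k -> N -> N),
    (forall i, automorphism (f i)) /\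
    forall g, automorphism g ->
      exists i q, outer_eq g (f i \o sigma q).

Definition Rip (R : realType) (N Q : groupType) (sigma : action N Q) : Prop :=
  (finitely_generated Q /\ torsion_free Q) /\
  [/\ exists H : groupType,
        [/\ torsion_free H, ~ elementary H, hyperbolic_group R H,
            property_T R H &
            exists f : {multiplicative H -> N}, range f = [set: N]],
      sdprod_right sigma <> [set: sdprod sigma] /\
        relatively_hyperbolic (sdprod_right sigma),
      torsion_free (sdprod sigma) &
      Out_injective sigma /\ Out_finite_index_image sigma].

Definition Rip_T (R : realType) (N Q : groupType) (sigma : action N Q) : Prop :=
  Rip R sigma /\ property_T R Q.

Section RealSum.
Context {R : realType} {T : choiceType}.
Implicit Types f g a b : T -> R.

Definition summableR f : bool := summable [set: T] (EFin \o f).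

(* The sum of an absolutely summable real family; without summability the value
   is meaningless. *)
Definition rsum f : R :=
  fine (\esum_(x in [set: T]) (Num.max (f x) 0)%:E) -
  fine (\esum_(x in [set: T]) (Num.max (- f x) 0)%:E).

Lemma esum_fin a b : (forall x, 0 <= a x <= b x) -> summableR b ->
  (\esum_(x in [set: T]) (a x)%:E)%E \is a fin_num.
Proof.
move=> ab sb; rewrite ge0_fin_numE; last first.
  by apply: esum_ge0 => x _; rewrite lee_fin; case/andP: (ab x).
apply: le_lt_trans sb; apply: le_esum => x _ /=.
case/andP: (ab x) => a0 aleb; rewrite lee_fin ger0_norm //.
exact: le_trans aleb.
Qed.

Lemma rsumE f a b : (forall x, 0 <= a x) -> (forall x, 0 <= b x) ->
  summableR a -> summableR b -> (forall x, f x = a x - b x) ->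
  rsum f = fine (\esum_(x in [set: T]) (a x)%:E) -
           fine (\esum_(x in [set: T]) (b x)%:E).
Proof.
move=> a0 b0 sa sb fE; rewrite /rsum.
pose p x := Num.max (f x) 0; pose n x := Num.max (- f x) 0.
have p0 x : 0 <= p x by rewrite /p le_max lexx orbT.
have n0 x : 0 <= n x by rewrite /n le_max lexx orbT.
have Fp : (\esum_(x in [set: T]) (p x)%:E)%E \is a fin_num.
  apply: (esum_fin _ sa) => x; rewrite p0 /p ge_max a0 fE andbT.
  by have := b0 x; lra.
have Fn : (\esum_(x in [set: T]) (n x)%:E)%E \is a fin_num.
  apply: (esum_fin _ sb) => x; rewrite n0 /n ge_max b0 fE andbT.
  by have := a0 x; lra.
have Fa : (\esum_(x in [set: T]) (a x)%:E)%E \is a fin_num.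
  by apply: (esum_fin _ sa) => x; rewrite a0 lexx.
have Fb : (\esum_(x in [set: T]) (b x)%:E)%E \is a fin_num.
  by apply: (esum_fin _ sb) => x; rewrite b0 lexx.
suff H : fine (\esum_(x in [set: T]) (p x)%:E) + fine (\esum_(x in [set: T]) (b x)%:E)
   = fine (\esum_(x in [set: T]) (a x)%:E) + fine (\esum_(x in [set: T]) (n x)%:E).
  by rewrite -/(p _) -/(n _); move: H; rewrite /p /n; lra.
rewrite -!fineD // -!esumD; try by move=> i _; rewrite lee_fin.
congr fine; apply: eq_esum => x _; rewrite -!EFinD; congr EFin.
have := fE x; rewrite /p /n; case: (ltP (f x) 0) => h1; case: (ltP (- f x) 0) => h2; lra.
Qed.

Lemma eq_rsum f g : f =1 g -> rsum f = rsum g.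
Proof. by move=> /funext ->. Qed.

Lemma summableR_le f a : (forall x, `|f x| <= a x) -> summableR a -> summableR f.
Proof.
move=> fa; apply: le_lt_trans; apply: le_esum => x _ /=.
by rewrite lee_fin (le_trans (fa x)) // ler_norm.
Qed.

Lemma summableRD f g : summableR f -> summableR g ->
  summableR (fun x => f x + g x).
Proof. by move=> sf sg; have := summableD sf sg. Qed.

Lemma esumZ c a : 0 <= c -> (forall x, 0 <= a x) ->
  (\esum_(x in [set: T]) (c * a x)%:E =
   c%:E * \esum_(x in [set: T]) (a x)%:E)%E.
Proof.
move=> c0 a0; rewrite /esum -ereal_supZl //; last first.
  by apply/set0P; exists (\sum_(x \in set0) (a x)%:E)%E; exists set0; first exact: fsets_set0.
congr ereal_sup; rewrite eqEsubset; split=> [_ [A fA <-]|_ [_ [A fA <-] <-]].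
  by exists (\sum_(x \in A) (a x)%:E)%E; [exists A|rewrite ge0_mule_fsumr// => i; rewrite lee_fin].
by exists A => //; rewrite ge0_mule_fsumr// => i; rewrite lee_fin.
Qed.

Lemma summableRZ c f : summableR f -> summableR (fun x => c * f x).
Proof.
move=> sf; rewrite /summableR /summable.
rewrite (eq_esum (b := fun x => (`|c| * `|f x|)%:E)); last first.
  by move=> x _ /=; rewrite normrM.
rewrite esumZ //; exact: lte_mul_pinfty.
Qed.

Lemma summableRN f : summableR f -> summableR (fun x => - f x).
Proof.
by rewrite /summableR summableN.
Qed.

Let pos f x : R := Num.max (f x) 0.
Let neg f x : R := Num.max (- f x) 0.
Let pos0 f x : 0 <= pos f x. Proof. by rewrite /pos le_max lexx orbT. Qed.
Let neg0 f x : 0 <= neg f x. Proof. by rewrite /neg le_max lexx orbT. Qed.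
Let abs_le f x : `|pos f x| <= `|f x| /\ `|neg f x| <= `|f x|.
Proof.
rewrite (ger0_norm (pos0 f x)) (ger0_norm (neg0 f x)) /pos /neg !ge_max.
by rewrite !normr_ge0 ler_norm ler_normr lexx orbT.
Qed.
Let spos f : summableR f -> summableR (pos f).
Proof.
by apply: le_lt_trans; apply: le_esum => x _; rewrite lee_fin; case: (abs_le f x).
Qed.
Let sneg f : summableR f -> summableR (neg f).
Proof.
by apply: le_lt_trans; apply: le_esum => x _; rewrite lee_fin; case: (abs_le f x).
Qed.
Let posneg f x : f x = pos f x - neg f x.
Proof. by rewrite /pos /neg; case: (ltP (f x) 0); case: (ltP (- f x) 0); lra. Qed.
Let fin f : (forall x, 0 <= f x) -> summableR f ->
  (\esum_(x in [set: T]) (f x)%:E)%E \is a fin_num.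
Proof. by move=> f0 sf; apply: (esum_fin _ sf) => x; rewrite f0 lexx. Qed.

Let fpos f : summableR f -> (\esum_(x in [set: T]) (pos f x)%:E)%E \is a fin_num.
Proof. by move=> sf; apply: fin; [exact: pos0|exact: spos]. Qed.
Let fneg f : summableR f -> (\esum_(x in [set: T]) (neg f x)%:E)%E \is a fin_num.
Proof. by move=> sf; apply: fin; [exact: neg0|exact: sneg]. Qed.

Lemma rsumD f g : summableR f -> summableR g ->
  rsum (fun x => f x + g x) = rsum f + rsum g.
Proof.
move=> sf sg.
rewrite (@rsumE _ (fun x => pos f x + pos g x) (fun x => neg f x + neg g x)).
- under eq_esum do rewrite EFinD.
  under [X in _ - fine X]eq_esum do rewrite EFinD.
  rewrite !esumD; try by move=> *; rewrite lee_fin.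
  rewrite !fineD; [by rewrite opprD addrACA|exact: fneg|exact: fneg|exact: fpos|exact: fpos].
- by move=> x; rewrite addr_ge0.
- by move=> x; rewrite addr_ge0.
- by apply: summableRD; exact: spos.
- by apply: summableRD; exact: sneg.
- by move=> x; rewrite {1}(posneg f x) {1}(posneg g x); lra.
Qed.

Lemma rsumN f : rsum (fun x => - f x) = - rsum f.
Proof. by rewrite /rsum; under [X in _ - fine X]eq_esum do rewrite opprK; rewrite opprB. Qed.

Lemma rsumZ c f : summableR f -> rsum (fun x => c * f x) = c * rsum f.
Proof.
move=> sf.
wlog c0 : c / 0 <= c.
  move=> H; case: (leP 0 c) => [/H//|cn].
  have := H (- c); rewrite oppr_ge0 => /(_ (ltW cn)).
  under eq_rsum do rewrite mulNr.
  by rewrite rsumN mulNr => /oppr_inj.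
rewrite (@rsumE _ (fun x => c * pos f x) (fun x => c * neg f x)).
- rewrite !esumZ //; rewrite !fineM //; [by rewrite -mulrBr|exact: fneg|exact: fpos].
- by move=> x; rewrite mulr_ge0.
- by move=> x; rewrite mulr_ge0.
- exact/summableRZ/spos.
- exact/summableRZ/sneg.
- by move=> x; rewrite {1}(posneg f x); lra.
Qed.

Lemma rsum_ge f t : (forall x, 0 <= f x) -> summableR f -> f t <= rsum f.
Proof.
move=> f0 sf; rewrite (@rsumE _ f (fun=> 0)) //; last 2 first.
- by rewrite /summableR /summable esum1 // => x _ /=; rewrite normr0.
- by move=> x; rewrite subr0.
rewrite [X in _ - fine X]esum1 // subr0 -lee_fin fineK ?fin //.
apply: esum_ge; exists [set t]; first by split.
by rewrite fsbig_set1.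
Qed.
End RealSum.

Section ell2.
Context {R : realType} {T : choiceType}.
Local Notation C := R[i].

Definition sqabs (z : C) : R := complex.Re z ^+ 2 + complex.Im z ^+ 2.

Definition sq_summable : {pred T -> C} := fun f => summableR (fun x => sqabs (f x)).

Lemma sqabs_ge0 z : 0 <= sqabs z.
Proof. by rewrite addr_ge0 // sqr_ge0. Qed.

Lemma sq_summable_submod : submod_closed sq_summable.
Proof.
split=> [|c f g sf sg].
  rewrite unfold_in /summableR /summable esum1 // => x _ /=.
  by rewrite /sqabs /= expr0n addr0 normr0.
have : summableR (fun x => 2 * (sqabs c * sqabs (f x)) + 2 * sqabs (g x)).
  by apply: summableRD; apply: summableRZ => //; exact: summableRZ.
apply: summableR_le => x; rewrite ger0_norm ?sqabs_ge0 //.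
rewrite [(c *: f + g) x]/(c * f x + g x).
move: c (f x) (g x) => [c1 c2] [a1 a2] [b1 b2]; rewrite /sqabs /=.
have H1 := sqr_ge0 (c1 * a1 - c2 * a2 - b1).
have H2 := sqr_ge0 (c1 * a2 + c2 * a1 - b2).
rewrite -subr_ge0; apply: (le_trans (addr_ge0 H1 H2)).
by rewrite le_eqVlt; apply/orP; left; apply/eqP; ring.
Qed.

HB.instance Definition _ :=
  GRing.isSubmodClosed.Build C (T -> C) sq_summable sq_summable_submod.
End ell2.

Record ell2 (R : realType) (T : choiceType) := Ell2 {
  ell2_fun :> T -> R[i];
  ell2P : sq_summable ell2_fun }.

HB.instance Definition _ (R : realType) (T : choiceType) := [isSub for @ell2_fun R T].
HB.instance Definition _ (R : realType) (T : choiceType) := [Choice of ell2 R T by <:].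
HB.instance Definition _ (R : realType) (T : choiceType) :=
  [SubChoice_isSubLmodule of ell2 R T by <:].

Section ell2dot.
Context {R : realType} {T : choiceType}.
Local Notation C := R[i].
Implicit Types u v w : ell2 R T.

Definition csum (f : T -> C) : C :=
  Complex (rsum (fun x => complex.Re (f x))) (rsum (fun x => complex.Im (f x))).

(* Linear on the left, conjugate-linear on the right. *)
Definition ell2_dot u v : C := csum (fun x => u x * Num.conj (v x)).

Lemma conjCE (z : C) : Num.conj z = Complex (complex.Re z) (- complex.Im z).
Proof. by case: z. Qed.

Let sprod u v : summableR (fun x => complex.Re (u x * Num.conj (v x))) /\
   summableR (fun x => complex.Im (u x * Num.conj (v x))).
Proof.
have S := summableRD (ell2P u) (ell2P v).
split; apply: summableR_le S => x; rewrite conjCE;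
  case: (u x) (v x) => [a b] [c d]; rewrite /sqabs /= ler_norml.
all: have := sqr_ge0 (a - c); have := sqr_ge0 (a + c).
all: have := sqr_ge0 (b - d); have := sqr_ge0 (b + d).
all: have := sqr_ge0 (a - d); have := sqr_ge0 (a + d).
all: have := sqr_ge0 (b - c); have := sqr_ge0 (b + c).
all: move=> *; apply/andP; split; lra.
Qed.

Lemma ell2_dot_linearl v : GRing.linear_for *%R (ell2_dot^~ v).
Proof.
move=> c u w; rewrite /ell2_dot /csum.
have [s1 s2] := sprod u v; have [s3 s4] := sprod w v.
have E x : (c *: u + w) x * (v x)^* = c * (u x * (v x)^*) + w x * (v x)^*.
  by rewrite [(c *: u + w) x]/(c * u x + w x) mulrDl mulrA.
set U := fun x => u x * (v x)^* in s1 s2 E *.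
set W := fun x => w x * (v x)^* in s3 s4 E *.
under eq_rsum do rewrite E.
under [X in Complex _ X]eq_rsum do rewrite E.
rewrite -/(U _) -/(W _).
case: c {E} => c1 c2.
have E1 : (fun x => complex.Re (Complex c1 c2 * U x + W x)) =
  (fun x => (c1 * complex.Re (U x) + (- c2) * complex.Im (U x)) + complex.Re (W x)).
  by apply/funext => x; case: (U x) (W x) => [a b] [a' b'] /=; ring.
have E2 : (fun x => complex.Im (Complex c1 c2 * U x + W x)) =
  (fun x => (c1 * complex.Im (U x) + c2 * complex.Re (U x)) + complex.Im (W x)).
  by apply/funext => x; case: (U x) (W x) => [a b] [a' b'] /=; ring.
rewrite [X in Complex (rsum X)]E1 [X in Complex _ (rsum X)]E2.
have z1 := summableRZ c1 s1; have z2 := summableRZ (- c2) s2.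
have z3 := summableRZ c1 s2; have z4 := summableRZ c2 s1.
rewrite (rsumD (summableRD z1 z2) s3) (rsumD z1 z2) (rsumZ c1 s1) (rsumZ (- c2) s2).
rewrite (rsumD (summableRD z3 z4) s4) (rsumD z3 z4) (rsumZ c1 s2) (rsumZ c2 s1).
by rewrite mulNr (addrC (c1 * rsum _) (c2 * _)) (addrC (c2 * _)).
Qed.

Lemma ell2_dotC u v : ell2_dot u v = Num.conj (ell2_dot v u).
Proof.
rewrite /ell2_dot /csum conjCE /= -rsumN; congr Complex; apply: eq_rsum => x;
  rewrite !conjCE; case: (u x) (v x) => [a b] [c d] /=; ring.
Qed.

Lemma ell2_dot_linearr u :
  GRing.linear_for (Num.conj \; *%R) (ell2_dot u).
Proof.
by move=> c v w; rewrite ell2_dotC ell2_dot_linearl rmorphD rmorphM /= -2!ell2_dotC.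
Qed.

Lemma ell2_dot_hermitian u v :
  ell2_dot u v = (-1) ^+ false * Num.conj (ell2_dot v u).
Proof. by rewrite expr0 mul1r; exact: ell2_dotC. Qed.

Lemma ell2_dot_gt0 u : u != 0 -> 0 < ell2_dot u u.
Proof.
move=> u0.
have [t ut] : exists t, u t != 0.
  apply/not_existsP => H; move/eqP: u0; apply; apply: val_inj; apply/funext => t.
  by apply/eqP; apply: contrapT => /negP /H.
have E x : u x * Num.conj (u x) = Complex (sqabs (u x)) 0.
  by rewrite conjCE; case: (u x) => a b; apply/eqP; rewrite eq_complex /sqabs /=;
    apply/andP; split; apply/eqP; ring.
rewrite /ell2_dot /csum.
rewrite (eq_rsum (g := fun x => sqabs (u x))); last by move=> x; rewrite E.
rewrite [X in Complex _ X](eq_rsum (g := fun x => 0 * sqabs (u x))); last first.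
  by move=> x; rewrite E mul0r.
rewrite (rsumZ 0 (ell2P u)) mul0r ltcE /= eqxx /=.
apply: lt_le_trans (rsum_ge t _ (ell2P u)); last by move=> x; exact: sqabs_ge0.
rewrite lt_neqAle sqabs_ge0 andbT eq_sym; apply: contra ut.
rewrite /sqabs paddr_eq0 ?sqr_ge0 // !sqrf_eq0.
by case: (u t) => a b /= /andP[/eqP -> /eqP ->].
Qed.

HB.instance Definition _ := @bilinear_isBilinear.Build C (ell2 R T) (ell2 R T) C
  *%R (Num.conj \; *%R) ell2_dot (ell2_dot_linearl, ell2_dot_linearr).
HB.instance Definition _ := @isHermitianSesquilinear.Build C (ell2 R T) false
  Num.conj ell2_dot ell2_dot_hermitian.
HB.instance Definition _ := @isDotProduct.Build C (ell2 R T) ell2_dot ell2_dot_gt0.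

End ell2dot.

Section LeftRegular.
Context {R : realType} {G : groupType}.

Lemma left_regular_subproof (g : G) (u : ell2 R G) :
  sq_summable (fun x => u (g^-1 * x)%g).
Proof.
rewrite /sq_summable /summableR /summable.
have -> : (\esum_(x in [set: G]) `|(EFin \o (fun x => sqabs (u (g^-1 * x)%g))) x|)%E
  = (\esum_(x in [set: G]) `|(EFin \o (fun x => sqabs (u x))) x|)%E.
  rewrite [RHS](@reindex_esum R G G [set: G] [set: G] (fun x => (g^-1 * x)%g)) //.
  split=> //; first by move=> x y _ _; exact: mulgI.
  by move=> y _; exists (g * y)%g => //; rewrite mulKg.
exact: ell2P.
Qed.

Definition left_regular (g : G) (u : ell2 R G) : ell2 R G :=
  Ell2 (left_regular_subproof g u).

End LeftRegular.

(* For a subgroup H of G, the von Neumann algebra on l^2(G) generated by the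
   left translations by elements of H.  It is L(G) for H = G, and in general
   the canonical copy of L(H) inside L(G). *)
Definition group_vN (R : realType) (G : groupType) (H : set G) :
  set (ell2 R G -> ell2 R G) :=
  commutant ell2_dot
    (commutant ell2_dot [set @left_regular R G h | h in H]).
Arguments group_vN R {G} H.

(* Main.v *)
(* Write G = N x| Q and let L(N x| Qm) <= P <= L(G).

   Every nontrivial x in G has infinitely many conjugates under N.  Integrating a
   function phi on G over the Q-letters of a word gives a cocycle invariant in
   the free product of Q with a free group; when phi is 1-Lipschitz along the
   finitely many Q-letters of the relators, the linear relative Dehn function
   bounds its value on a relation by the length of the relation.  The commutator
   of a and q^-1 a q, with a in N, has length independent of q in Q, so for
   a <> 1 it is a relation for finitely many q only.  If a had finitely many
   conjugates under N, then a power of a would commute with all q^-1 a q, for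
   infinitely many q.  Hence N has infinite conjugacy classes, and injectivity of
   Q -> Out(N) extends this to the conjugates under N of elements of G.

   Choda's argument then shows that a translation by g belongs to P as soon as
   some element of P has a nonzero g-th Fourier coefficient.  So P is generated
   by the translations it contains, which are those by N x| K for some subgroup
   K of Q containing Qm, and maximality of Qm leaves K = Qm or K = Q. *)
Require Import Defs.
From HB Require Import structures.
From mathcomp Require Import all_boot all_order all_algebra.
From mathcomp Require Import all_classical all_reals all_analysis.
From mathcomp Require Import complex sesquilinear.
From mathcomp Require Import zify ring lra.
Set Implicit Arguments.
Unset Strict Implicit.
Unset Printing Implicit Defensive.
Import Order.TTheory GRing.Theory Num.Theory.
Local Open Scope classical_set_scope.
Local Open Scope ring_scope.

(** * Words over a relative presentation *)

Section Jump.
Variables (G : groupType) (H X : set G) (phi : G -> int).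
Implicit Types (g : G) (a : letter H X) (v w r f : word H X).

(** Only H-letters count. If X-letters were included, the sum along a word would telescope to the
    difference of [phi] at the end points and vanish on every relation. *)
Definition letter_jump g a : int :=
  if a.1 is inr _ then phi (g * letter_eval a)%g - phi g else 0.

Fixpoint jump g w : int :=
  if w is a :: w' then letter_jump g a + jump (g * letter_eval a)%g w' else 0.

Lemma letter_eval_inv a : letter_eval (letter_inv a) = (letter_eval a)^-1%g.
Proof. by case: a => [[x|h] []] //=; rewrite /letter_eval /= invgK. Qed.

Lemma word_eval_nil : word_eval ([::] : word H X) = 1%g.
Proof. by rewrite /word_eval big_nil. Qed.

Lemma word_eval_cons a w : word_eval (a :: w) = (letter_eval a * word_eval w)%g.
Proof. by rewrite /word_eval big_cons. Qed.

Lemma word_eval_cat v w : word_eval (v ++ w) = (word_eval v * word_eval w)%g.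
Proof. by rewrite /word_eval big_cat. Qed.

Lemma word_inv_cons a w : word_inv (a :: w) = word_inv w ++ [:: letter_inv a].
Proof. by rewrite /word_inv /= rev_cons cats1. Qed.

Lemma word_eval_inv w : word_eval (word_inv w) = (word_eval w)^-1%g.
Proof.
elim: w => [|a w IH]; first by rewrite word_eval_nil invg1.
rewrite word_inv_cons word_eval_cat word_eval_cons word_eval_nil IH mulg1.
by rewrite letter_eval_inv word_eval_cons invgM.
Qed.

Lemma size_word_inv w : size (word_inv w) = size w.
Proof. by rewrite size_rev size_map. Qed.

Lemma jump_cat g v w : jump g (v ++ w) = jump g v + jump (g * word_eval v)%g w.
Proof.
elim: v g => [|a v IH] g /=; first by rewrite word_eval_nil mulg1 add0r.
by rewrite IH word_eval_cons mulgA addrA.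
Qed.

Lemma letter_jump_inv g a :
  letter_jump (g * letter_eval a)%g (letter_inv a) = - letter_jump g a.
Proof.
rewrite /letter_jump letter_eval_inv mulgK.
by case: a => [[x|h] b] /=; rewrite ?oppr0 ?opprB.
Qed.

Lemma jump_inv g w : jump (g * word_eval w)%g (word_inv w) = - jump g w.
Proof.
elim: w g => [|a w IH] g /=; first by rewrite oppr0.
rewrite word_inv_cons jump_cat word_eval_cons mulgA IH word_eval_inv mulgK /=.
by rewrite letter_jump_inv addr0 -opprD addrC.
Qed.

(** Two consecutive H-letters telescope to their product and an inverse letter retraces its edge, so
    [jump] descends to the free product. *)
Lemma free_product_eq_jump v w : free_product_eq v w ->
  word_eval v = word_eval w /\ forall g, jump g v = jump g w.
Proof.
elim=> {v w} [//|v w _ [e J]|u v w _ [e1 J1] _ [e2 J2]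
  |v v' w w' _ [e1 J1] _ [e2 J2]|a|h k l hkl].
- by split.
- by split=> [|g]; [rewrite e1|rewrite J1].
- by rewrite !word_eval_cat e1 e2; split=> // g; rewrite !jump_cat J1 J2 e1.
- rewrite !word_eval_cons word_eval_nil mulg1 letter_eval_inv mulgV.
  by split=> // g /=; rewrite letter_jump_inv addr0 subrr.
- rewrite !word_eval_cons word_eval_nil !mulg1 /letter_eval /= hkl.
  by split=> // g /=; rewrite /letter_jump /letter_eval /= hkl mulgA !addr0 addrC subrKA.
Qed.

(** A relator returns to its starting point, so the two passages along [f] cancel. *)
Lemma jump_conj g f r : word_eval r = 1%g ->
  jump g (word_inv f ++ r ++ f) = jump (g * (word_eval f)^-1)%g r.
Proof.
move=> r1; rewrite !jump_cat word_eval_inv r1 mulg1.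
have := jump_inv (g * (word_eval f)^-1) f; rewrite mulgVK => ->; lia.
Qed.

Lemma jump_size g w :
  (forall a, List.In a w -> forall x, `|letter_jump x a| <= 1) ->
  `|jump g w| <= (size w)%:Z.
Proof.
elim: w g => [|a w IH] g //= aw.
have := IH (g * letter_eval a)%g (fun b bw => aw b (or_intror bw)).
have := aw a (or_introl erefl) g; lia.
Qed.

(** Each conjugate contributes the jump of its relator read from a shifted base point; this is why
    the bound is assumed at all base points. *)
Lemma jump_conjugates g (M : nat) (ps : seq (word H X * word H X * bool)) :
  (forall p, List.In p ps -> word_eval p.1.2 = 1%g) ->
  (forall p, List.In p ps -> forall x, `|jump x p.1.2| <= M%:Z) ->
  word_eval (conjugates ps) = 1%g /\ `|jump g (conjugates ps)| <= (M * size ps)%:Z.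
Proof.
elim: ps g => [|[[f r] s] ps IH] g /= ev1 bd.
  by rewrite word_eval_nil; split.
have r1 : word_eval r = 1%g := ev1 _ (or_introl erefl).
have rM x : `|jump x r| <= M%:Z := bd _ (or_introl erefl) x.
have s1 : word_eval (if s then r else word_inv r) = 1%g.
  by case: s {ev1 bd}; rewrite ?word_eval_inv r1 ?invg1.
have sM x : `|jump x (if s then r else word_inv r)| <= M%:Z.
  case: s {ev1 bd s1} => //.
  by have := jump_inv x r; rewrite r1 mulg1 => ->; rewrite normrN.
have [e b] := IH g (fun p pps => ev1 p (or_intror pps))
  (fun p pps => bd p (or_intror pps)).
rewrite /conjugates /= -/(conjugates ps).
have c1 : word_eval (word_inv f ++ (if s then r else word_inv r) ++ f) = 1%g.
  by rewrite !word_eval_cat s1 mul1g word_eval_inv mulVg.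
rewrite word_eval_cat jump_cat c1 e !mulg1 jump_conj //; split=> //.
rewrite mulnS; have := sM (g * (word_eval f)^-1)%g; move: b.
move: (jump _ _) (jump _ _) (M * size ps)%N => x y z; lia.
Qed.

End Jump.

Lemma finite_nat_bounded (T : Type) (A : set T) (f : T -> nat) :
  finite_set A -> exists M : nat, forall x, A x -> (f x <= M)%N.
Proof.
move=> /(finite_image f) /finite_seqP[s sE].
exists (\max_(i <- s) i)%N => x Ax.
have fxs : f x \in s.
  by have : (f @` A) (f x) by [exists x]; rewrite sE.
exact: leq_bigmax_seq.
Qed.

Lemma word_eval_surj (G : groupType) (H X : set G) : generates (X `|` H) ->
  forall g, exists w : word H X, word_eval w = g.
Proof.
move=> gen g.
have : generated (X `|` H) g by rewrite gen.
move=> /(_ [set x | exists w : word H X, word_eval w = x]); apply.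
split=> [|x [Xx|Hx]].
- split=> [|_ _ [v <-] [w <-]|_ [w <-]].
  + by exists [::]; rewrite word_eval_nil.
  + by exists (v ++ w); rewrite word_eval_cat.
  + by exists (word_inv w); rewrite word_eval_inv.
- exists [:: (inl (SigSub (mem_set Xx)), true)].
  by rewrite word_eval_cons word_eval_nil mulg1.
- exists [:: (inr (SigSub (mem_set Hx)), true)].
  by rewrite word_eval_cons word_eval_nil mulg1.
Qed.

(** A relation of length l is a product of at most C * l conjugates of relators, and each relator
    contributes at most its length. Both [O] and [K] depend only on the presentation, so [phi] may
    be chosen afterwards. *)
Lemma relative_jump_bound (G : groupType) (H X : set G)
    (rels : set (word H X)) (C : nat) :
  subgroup H -> finite_set rels -> linear_relative_presentation rels C ->
  exists (O : set G) (K : nat), finite_set O /\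
    forall phi : G -> int,
      (forall x o, O o -> H o -> `|phi (x * o)%g - phi x| <= 1) ->
      forall w : word H X, word_eval w = 1%g ->
        `|jump phi 1%g w| <= (K * size w)%:Z.
Proof.
move=> [_ _ HV] frels [_ rels1 dehn].
have [M Mbd] := finite_nat_bounded size frels.
pose O := \bigcup_(r in rels) [set` map (@letter_eval G H X) r].
exists O, (M * C)%N; split.
  by apply: bigcup_finite => // r _; exact: finite_seq.
move=> phi lip w w1; have [ps [psr szps fpe]] := dehn w w1.
have [_ ->] := free_product_eq_jump phi fpe.
have psM p : List.In p ps -> forall x, `|jump phi x p.1.2| <= M%:Z.
  move=> pps x; apply: le_trans (_ : _ <= (size p.1.2)%:Z) _; last first.
    by rewrite lez_nat; apply: Mbd; exact: psr.
  apply: jump_size => a ap y.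
  rewrite /letter_jump; case E : a.1 => [z|h]; first by rewrite normr0.
  apply: lip; last first.
    have Hh := set_mem (valP h).
    by rewrite /letter_eval E; case: (a.2) => //; exact: HV.
  exists p.1.2; first exact: psr.
  rewrite /=; elim: (p.1.2) ap => //= b r IH [->|/IH abr].
    by rewrite mem_head.
  by rewrite in_cons abr orbT.
have [_ b] := jump_conjugates 1%g (fun p pps => rels1 _ (psr p pps)) psM.
apply: le_trans b _; rewrite lez_nat -mulnA leq_mul2l; apply/orP; right.
exact: szps.
Qed.

(** * Word length cut off at a bound, and commuting conjugates *)

Section WordBall.
Variables (G : groupType) (O : set G).

Fixpoint word_ball n : set G :=
  if n is n'.+1 then
    word_ball n' `|` [set (x * o)%g | x in word_ball n' & o in O]
  else [set 1%g].

Lemma word_ball_finite n : finite_set O -> finite_set (word_ball n).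
Proof.
move=> fO; elim: n => [|n IH] /=; first exact: finite_set1.
by rewrite finite_setU; split=> //; exact: finite_image2.
Qed.

Lemma word_ball_mul n x o : word_ball n x -> O o -> word_ball n.+1 (x * o)%g.
Proof. by move=> Bx Oo; right; exists x => //; exists o. Qed.

Lemma word_ball_le m n : (m <= n)%N -> word_ball m `<=` word_ball n.
Proof.
by move=> /subnK <-; elim: (n - m)%N => // k IH x /IH; rewrite addSn; left.
Qed.

(* The distance from 1 to x in the Cayley graph with respect to O, cut off
   at L. *)
Definition cut_length L x : nat := \sum_(i < L) `[< ~ word_ball i x >].

Lemma cut_length1 L : cut_length L 1%g = 0%N.
Proof.
rewrite /cut_length big1 // => i _; rewrite asboolF //.
by apply; apply: (word_ball_le (leq0n i)).
Qed.

Lemma cut_length_far L x : ~ word_ball L x -> cut_length L x = L.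
Proof.
move=> Bx; rewrite /cut_length (eq_bigr (fun=> 1%N)) => [|i _].
  by rewrite sum1_card card_ord.
rewrite asboolT // => Bix; apply: Bx.
exact: (word_ball_le (ltnW (ltn_ord i)) Bix).
Qed.

Lemma cut_length_step L x o : O o -> (cut_length L (x * o) <= (cut_length L x).+1)%N.
Proof.
move=> Oo; case: L => [|L]; first by rewrite /cut_length big_ord0.
(* The term of index i + 1 for x * o is at most the term of index i for x; the term of index 0
   accounts for the added 1. *)
rewrite {1}/cut_length big_ord_recl /cut_length big_ord_recr /=.
rewrite -add1n leq_add ?leq_b1 //; apply: leq_trans (leq_addr _ _).
apply: leq_sum => i _; case: asboolP => // nB.
rewrite asboolT // => Bx; apply: nB; exact: word_ball_mul.
Qed.

Lemma cut_length_lipschitz L x o : O o -> O o^-1%g ->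
  `|(cut_length L (x * o))%:Z - (cut_length L x)%:Z| <= 1.
Proof.
move=> Oo Oo'; have := cut_length_step L x Oo.
have := cut_length_step L (x * o)%g Oo'; rewrite mulgK.
move: (cut_length _ _) (cut_length _ _) => m n; lia.
Qed.

End WordBall.

(** The commutator of [a] with its conjugate b by q is read as a relation. Its first letter makes a
    jump of L when q^-1 is far from 1, while the other q-letters start outside [H] and make none.
    The last condition on q handles the case where b * a lies in [H], in which a shorter relation is
    available. *)
Lemma peripheral_commuting_finite (G : groupType) (H : set G) a :
  relatively_hyperbolic H -> ~ H a ->
  finite_set [set q | [/\ H q, commute (q^-1 * a * q)%g a &
                          H (q^-1 * a * q * a)%g -> (q^-1 * a * q * a)%g = 1%g]].
Proof.
move=> [sH [X [_ [rels [frels [C pres]]]]]] nHa.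
have [H1 HM HV] := sH.
have [Om [K [fO bound]]] := relative_jump_bound sH frels pres.
have [wa waE] : exists w : word H X, word_eval w = a.
  by case: pres => gen _ _; exact: word_eval_surj.
pose O1 : set G := Om `|` [set` map (@letter_eval G H X) wa].
(* Inverses are added because [cut_length] is Lipschitz along a letter only if its inverse is
   available too. *)
pose O2 := O1 `|` [set x^-1%g | x in O1].
have fO1 : finite_set O1 by rewrite finite_setU; split=> //; exact: finite_seq.
have fO2 : finite_set O2 by rewrite finite_setU; split=> //; exact: finite_image.
have O2V x : O2 x -> O2 x^-1%g.
  by case=> [Ox|[y Oy <-]]; [right; exists x|left; rewrite invgK].
pose m := size wa.
(* One more than the bound [K] gives for a word of length 4 + 4 * m, plus the most that the 4 * m
   letters of [wa] and its inverse can undo. *)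
pose L := (K * (4 + 4 * m) + 4 * m).+1.
(* Multiplication by an element of [H] never crosses the boundary of [H], so the extension by 0
   stays 1-Lipschitz along the letters lying in [H]. *)
pose phi x : int := if `[< H x >] then (cut_length O2 L x)%:Z else 0.
have phi0 x : ~ H x -> phi x = 0 by move=> nHx; rewrite /phi asboolF.
have lip x o : O2 o -> H o -> `|phi (x * o)%g - phi x| <= 1.
  move=> Oo Ho; rewrite /phi; case: asboolP => Hxo; case: asboolP => Hx.
  - by apply: cut_length_lipschitz => //; exact: O2V.
  - by case: Hx; rewrite -(mulgK o x); apply: HM => //; exact: HV.
  - by case: Hxo; exact: HM.
  - by rewrite subrr normr0.
apply: (@sub_finite_set _ _ [set x^-1%g | x in word_ball O2 L]); last first.
  by apply: finite_image; exact: word_ball_finite.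
move=> q [Hq com ba1]; exists q^-1%g; last by rewrite invgK.
apply: contrapT => far.
have Hq' := HV _ Hq.
pose up : letter H X := (inr (SigSub (mem_set Hq)), true).
pose un : letter H X := (inr (SigSub (mem_set Hq)), false).
set b := (q^-1 * a * q)%g in com ba1.
have nHb : ~ H b.
  move=> Hb; apply: nHa.
  have -> : a = (q * b * q^-1)%g by rewrite /b !mulgA mulgV mul1g mulgK.
  by apply: (HM) => //; exact: HM.
have jwa x : `|jump phi x wa| <= m%:Z.
  apply: jump_size => c cw y; rewrite /letter_jump.
  case E : c.1 => [z|h]; first by rewrite normr0.
  apply: lip.
    left; right; rewrite /=; elim: (wa) cw => //= d r IH [->|/IH cr].
      by rewrite mem_head.
    by rewrite in_cons cr orbT.
  have Hh := set_mem (valP h).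
  by rewrite /letter_eval E; case: (c.2) => //; exact: HV.
have jwaV x : `|jump phi x (word_inv wa)| <= m%:Z.
  have := jump_inv phi (x * a^-1)%g wa; rewrite waE mulgVK => ->.
  by rewrite normrN.
have upE : letter_eval up = q by [].
have unE : letter_eval un = q^-1%g by [].
(* The only large jump: q^-1 lies outside the ball of radius L. *)
have start : letter_jump phi 1%g un = L%:Z.
  rewrite /letter_jump /= unE mul1g /phi !asboolT // cut_length1 subr0.
  by rewrite cut_length_far.
have still x c : ~ H x -> (c = up \/ c = un) -> letter_jump phi x c = 0.
  move=> nHx cE; have Hc : H (letter_eval c) by case: cE => ->.
  have -> : letter_jump phi x c = phi (x * letter_eval c)%g - phi x.
    by case: cE => ->.
  rewrite !phi0 ?subrr // => Hxc; apply: nHx.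
  by rewrite -(mulgK (letter_eval c) x); apply: HM => //; exact: HV.
have nHqa : ~ H (q^-1 * a)%g.
  by move=> Hqa; apply: nHa; rewrite -(mulKg q^-1%g a); apply: HM => //; exact: HV.
have lipO x o : Om o -> H o -> `|phi (x * o)%g - phi x| <= 1.
  by move=> Oo; apply: lip; left; left.
have jump0 x : ~ H x -> letter_jump phi x up = 0 /\ letter_jump phi x un = 0.
  by move=> nHx; split; apply: still => //; [left|right].
have [jqa _] := jump0 _ nHqa.
have [ba|/contrapT/ba1 ba] := pselect (~ H (b * a)%g).
  (* This word spells b * a * b^-1 * a^-1, with b written as q^-1 * a * q. *)
  pose w := un :: wa ++ up :: wa ++ un :: word_inv wa ++ up :: word_inv wa.
  have bav : (b * a * q^-1 * a^-1 * q = a)%g.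
    by rewrite com /b !mulgA mulgK mulgK mulgVK.
  have w1 : word_eval w = 1%g.
    rewrite /w word_eval_cons !(word_eval_cat, word_eval_cons) unE upE.
    by rewrite !word_eval_inv waE !mulgA -/b bav mulgV.
  have := bound phi lipO w w1.
  rewrite /w /= jump_cat /= jump_cat /= jump_cat /= unE upE !word_eval_inv waE.
  rewrite mul1g start -/b jqa.
  have [_ ->] := jump0 _ ba.
  have [] // := jump0 (b * a * q^-1 * a^-1)%g.
    by move=> Hx; apply: nHa; rewrite -bav; exact: HM.
  move=> -> _.
  have := jwa q^-1%g; have := jwa b; have := jwaV (b * a * q^-1)%g.
  have := jwaV (b * a * q^-1 * a^-1 * q)%g.
  rewrite /= !size_cat /= !size_cat /= !size_cat /= size_word_inv -/m /L.
  move: (jump _ _ _) (jump _ _ _) (jump _ _ _) (jump _ _ _) => x y z t.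
  nia.
(* Here b * a = 1, so q^-1 * a * q * a is already a relation. *)
pose w := un :: wa ++ up :: wa.
have w1 : word_eval w = 1%g.
  by rewrite /w word_eval_cons word_eval_cat word_eval_cons unE upE waE !mulgA.
have := bound phi lipO w w1.
rewrite /w /= jump_cat /= waE unE mul1g start jqa.
have := jwa q^-1%g; have := jwa (q^-1 * a * letter_eval up)%g.
rewrite size_cat /= -/m /L.
move: (jump _ _ _) (jump _ _ _) => x y.
nia.
Qed.

(** By pigeonhole two of the powers 0, ..., size s of x conjugate a alike, so x ^+ d commutes with a
    for some 0 < d <= size s, and d divides the factorial. The resulting exponent does not depend on
    x. *)
Lemma commute_expg_fact (G : groupType) (a x : G) (s : seq G) :
  (forall i, (x ^+ i * a * (x ^+ i)^-1)%g \in s) -> commute (x ^+ (size s)`!)%g a.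
Proof.
move=> xs; pose t := mkseq (fun i => x ^+ i * a * (x ^+ i)^-1)%g (size s).+1.
have : ~~ uniq t.
  apply/negP => /uniq_leq_size ut.
  have /ut : {subset t <= s} by move=> _ /mapP[i _ ->].
  by rewrite size_mkseq ltnn.
case/(uniqPn 1%g) => i [j [ij]]; rewrite size_mkseq ltnS => js.
rewrite !nth_mkseq ?(leq_ltn_trans (ltnW ij)) // => eqij.
have : (size s)`! = ((j - i) * ((size s)`! %/ (j - i)))%N.
  rewrite mulnC divnK // dvdn_fact // subn_gt0 ij /=.
  exact: leq_trans (leq_subr _ _) js.
move=> ->; rewrite expgnA; apply/commute_sym/commuteX/commute_sym.
rewrite /commute; apply: (mulgI (x ^+ i)%g); apply: (mulIg (x ^+ j)^-1%g).
rewrite !mulgA -expgnDr subnKC ?(ltnW ij) //.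
rewrite -eqij -{2}(subnK (ltnW ij)) addnC expgnDr invgM !mulgA.
by rewrite mulgK.
Qed.

(** * Conjugacy classes under N in the semidirect product *)

Section SemidirectConjugacy.
Variables (N Q : groupType) (sigma : action N Q).
Local Notation G := (sdprod sigma).

Definition sdprod_inl (n : N) : G := (n, 1%g).
Definition sdprod_inr (q : Q) : G := (1%g, q).

Lemma sdprod_mulE (x y : G) : (x * y)%g = ((x.1 * sigma x.2 y.1)%g, (x.2 * y.2)%g).
Proof. by []. Qed.

Lemma sdprod_invE (x : G) : x^-1%g = (sigma (x.2^-1)%g (x.1^-1)%g, (x.2^-1)%g).
Proof. by []. Qed.

Lemma action_one q : sigma q 1%g = 1%g.
Proof.
have : (sigma q 1 * sigma q 1 = sigma q 1 * 1)%g by rewrite -act_mul !mulg1.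
exact: mulgI.
Qed.

Lemma action_expg q n k : sigma q (n ^+ k)%g = (sigma q n ^+ k)%g.
Proof. by elim: k => [|k IH]; rewrite ?action_one // !expgS act_mul IH. Qed.

Lemma sdprod_inlM m n : sdprod_inl (m * n)%g = (sdprod_inl m * sdprod_inl n)%g.
Proof. by rewrite sdprod_mulE /= act1 mulg1. Qed.

Lemma sdprod_inlV n : sdprod_inl n^-1%g = (sdprod_inl n)^-1%g.
Proof. by rewrite sdprod_invE /= invg1 act1. Qed.

Lemma sdprod_inlX n k : sdprod_inl (n ^+ k)%g = (sdprod_inl n ^+ k)%g.
Proof. by elim: k => // k IH; rewrite !expgS sdprod_inlM IH. Qed.

Lemma sdprod_inl_conj n q :
  ((sdprod_inr q)^-1 * sdprod_inl n * sdprod_inr q)%g = sdprod_inl (sigma q^-1%g n).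
Proof.
rewrite sdprod_invE !sdprod_mulE /= invg1 !action_one !mulg1 mul1g.
by rewrite mulVg.
Qed.

Definition normal_class (x : G) : set G :=
  [set (sdprod_inl n * x * (sdprod_inl n)^-1)%g | n in [set: N]].

Lemma normal_class_finiteM (x y : G) : finite_set (normal_class x) ->
  finite_set (normal_class y) -> finite_set (normal_class (x * y)%g).
Proof.
move=> fx fy; apply: (@sub_finite_set _ _
  [set (u * v)%g | u in normal_class x & v in normal_class y]).
  move=> _ [n _ <-]; exists (sdprod_inl n * x * (sdprod_inl n)^-1)%g.
    by exists n.
  exists (sdprod_inl n * y * (sdprod_inl n)^-1)%g; first by exists n.
  by rewrite !mulgA mulgVK.
exact: finite_image2.
Qed.

Lemma normal_class_finiteV (x : G) : finite_set (normal_class x) ->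
  finite_set (normal_class x^-1%g).
Proof.
move=> fx; apply: (@sub_finite_set _ _ [set u^-1%g | u in normal_class x]).
  move=> _ [n _ <-]; exists (sdprod_inl n * x * (sdprod_inl n)^-1)%g.
    by exists n.
  by rewrite !invgM invgK mulgA.
exact: finite_image.
Qed.

Lemma normal_class_finiteJ (x : G) n : finite_set (normal_class x) ->
  finite_set (normal_class (sdprod_inl n * x * (sdprod_inl n)^-1)%g).
Proof.
apply: sub_finite_set => _ [m _ <-]; exists (m * n)%g => //.
by rewrite sdprod_inlM invgM !mulgA.
Qed.

(** Let b be the power of [a] by the factorial of the number of listed conjugates. The conjugate of
    b by any q is the same power of an element of N, hence commutes with [a] and so with b. For
    nontrivial b this contradicts [peripheral_commuting_finite], and torsion-freeness passes from b
    = 1 to a = 1. *)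
Lemma normal_class_inl_finite (a : N) :
  ~ finite_set [set: Q] -> torsion_free G ->
  relatively_hyperbolic (sdprod_right sigma) ->
  finite_set (normal_class (sdprod_inl a)) -> a = 1%g.
Proof.
move=> infQ tf rh /finite_seqP[s sE]; apply: contrapT => na1.
pose b : N := (a ^+ (size s)`!)%g.
have com (x : N) : commute (sdprod_inl (x ^+ (size s)`!)%g) (sdprod_inl a).
  rewrite sdprod_inlX; apply: commute_expg_fact => i.
  have : normal_class (sdprod_inl a)
      (sdprod_inl (x ^+ i)%g * sdprod_inl a * (sdprod_inl (x ^+ i)%g)^-1)%g.
    by exists (x ^+ i)%g.
  by rewrite sE /= sdprod_inlX.
have right_inl (n : N) : sdprod_right sigma (sdprod_inl n) -> n = 1%g by [].
have nb1 : b <> 1%g.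
  move=> b1; apply: na1; suff: sdprod_inl a = 1%g by case.
  apply: (tf _ (size s)`!); first exact: fact_gt0.
  by rewrite -sdprod_inlX -/b b1.
have := peripheral_commuting_finite rh (a := sdprod_inl b) nb1.
move=> fin; apply: infQ; apply: (@sub_finite_set _ _ ((fun x : G => x.2) @` _)); last first.
  exact: finite_image fin.
move=> q _; exists (sdprod_inr q) => //=; rewrite /= sdprod_inl_conj; split=> //.
  rewrite {2}/b sdprod_inlX; apply: commuteX.
  by rewrite /b action_expg.
(* N meets the copy of Q trivially, which gives the side condition on the product. *)
by rewrite -sdprod_inlM => /right_inl ->.
Qed.

(** If x has a finite class, its commutators with N lie in N and have finite classes, so they are
    trivial and x centralizes N. Then x.2 acts on N as an inner automorphism, injectivity into
    Out(N) forces x.2 = 1, and x itself lies in N. *)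
Lemma normal_class_infinite (x : G) :
  ~ finite_set [set: Q] -> torsion_free G ->
  relatively_hyperbolic (sdprod_right sigma) -> Out_injective sigma ->
  finite_set (normal_class x) -> x = 1%g.
Proof.
move=> infQ tf rh inj fx.
have com (n : N) : commute (sdprod_inl n) x.
  pose y := (sdprod_inl n * x * (sdprod_inl n)^-1 * x^-1)%g.
  have yE : y = sdprod_inl y.1.
    rewrite [LHS](surjective_pairing y); congr pair.
    by rewrite /y !sdprod_mulE /= invg1 mulg1 mul1g mulgV.
  have fy : finite_set (normal_class y).
    apply: normal_class_finiteM; last exact: normal_class_finiteV.
    exact: normal_class_finiteJ.
  have y1 : y = 1%g.
    rewrite yE; move: fy; rewrite yE.
    by move/(normal_class_inl_finite infQ tf rh) => /= ->.
  apply: (mulIg (sdprod_inl n)^-1%g); apply: (mulIg x^-1%g).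
  by rewrite -/y y1 mulgK mulgV.
have x2 : x.2 = 1%g.
  apply: inj; exists x.1^-1%g => n; rewrite invgK act1.
  have := com n; rewrite /commute !sdprod_mulE /= act1 => -[e _].
  by rewrite -mulgA e mulKg.
have xE : x = sdprod_inl x.1 by rewrite [LHS](surjective_pairing x) x2.
rewrite xE; move: fx; rewrite xE.
by move/(normal_class_inl_finite infQ tf rh) => /= ->.
Qed.
End SemidirectConjugacy.

(** * Square-summable families and bounded operators *)

Section Ell2Theory.
Context {R : realType} {T : choiceType}.
Local Notation C := R[i].
Local Notation dot := (@ell2_dot R T).
Implicit Types (u v w : ell2 R T) (f : T -> C) (x y : T).

Lemma esum_support1 (f : T -> R) x : (forall y, 0 <= f y) ->
  (forall y, y != x -> f y = 0) -> (\esum_(y in [set: T]) (f y)%:E)%E = (f x)%:E.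
Proof.
move=> f0 fx; transitivity (\esum_(y in [set x]) (f y)%:E)%E; last first.
  by rewrite esum_set1 ?lee_fin.
rewrite [RHS]esum_mkcond; apply: eq_esum => y _; case: ifPn => //.
by rewrite notin_setE /= => /eqP yx; rewrite fx.
Qed.

Lemma rsum_support1 (f : T -> R) x : (forall y, y != x -> f y = 0) -> rsum f = f x.
Proof.
move=> fx; rewrite /rsum !(@esum_support1 _ x) /=.
- by case: (ltP (f x) 0) => h1; case: (ltP (- f x) 0) => h2; lra.
- by move=> y; rewrite le_max lexx orbT.
- by move=> y /fx ->; rewrite oppr0 maxxx.
- by move=> y; rewrite le_max lexx orbT.
- by move=> y /fx ->; rewrite maxxx.
Qed.

Lemma rsum_ge0E (f : T -> R) : (forall x, 0 <= f x) -> summableR f ->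
  rsum f = fine (\esum_(x in [set: T]) (f x)%:E).
Proof.
move=> f0 sf; rewrite (@rsumE _ _ f f (fun=> 0)) //.
- by rewrite [X in _ - fine X]esum1 // subr0.
- by rewrite /summableR /summable esum1 // => x _ /=; rewrite normr0.
- by move=> x; rewrite subr0.
Qed.

Lemma rsum_fset_bound (f : T -> R) (B : R) : (forall x, 0 <= f x) ->
  (forall s : seq T, uniq s -> \sum_(x <- s) f x <= B) ->
  summableR f /\ rsum f <= B.
Proof.
move=> f0 fB.
have le : (\esum_(x in [set: T]) (f x)%:E <= B%:E)%E.
  apply: ge_ereal_sup => _ [A [fA _] <-].
  rewrite fsbig_finite //= sumEFin lee_fin; apply: fB; exact: finmap.fset_uniq.
have sf : summableR f.
  rewrite /summableR /summable (eq_esum (b := fun x => (f x)%:E)).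
    exact: le_lt_trans le (ltry _).
  by move=> x _ /=; rewrite ger0_norm.
split=> //; rewrite rsum_ge0E // -lee_fin fineK //.
by apply: (esum_fin _ sf) => x; rewrite f0 lexx.
Qed.

Lemma rsum_approx (f : T -> R) (e : R) : (forall x, 0 <= f x) -> summableR f ->
  0 < e -> exists2 s : seq T, uniq s & rsum f - e < \sum_(x <- s) f x.
Proof.
move=> f0 sf e0.
have ffin : (\esum_(x in [set: T]) (f x)%:E)%E \is a fin_num.
  by apply: (esum_fin _ sf) => x; rewrite f0 lexx.
have [_ [A [fA _] <-]] := ub_ereal_sup_adherent e0 ffin.
rewrite fsbig_finite //= sumEFin => lt; exists (finmap.enum_fset (fset_set A)); first exact: finmap.fset_uniq.
by rewrite rsum_ge0E // -lte_fin EFinB fineK.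
Qed.

Definition sqnorm u : R := rsum (fun x => sqabs (u x)).

Lemma mulCconj (z : C) : z * Num.conj z = Complex (sqabs z) 0.
Proof. by rewrite conjCE; case: z => a b; congr Complex; rewrite /sqabs /=; ring. Qed.

Lemma sqabs_conj (z : C) : sqabs (Num.conj z) = sqabs z.
Proof. by rewrite conjCE /sqabs /= sqrrN. Qed.

Lemma ell2_dot_self u : dot u u = Complex (sqnorm u) 0.
Proof.
rewrite /ell2_dot /csum; congr Complex.
  by apply: eq_rsum => x; rewrite mulCconj.
rewrite (eq_rsum (g := fun x => 0 * sqabs (u x))); last by move=> x; rewrite mulCconj mul0r.
by rewrite (rsumZ 0 (ell2P u)) mul0r.
Qed.

Lemma hnormE u : hnorm dot u = Num.sqrt (sqnorm u).
Proof. by rewrite -[LHS]/(Num.sqrt (complex.Re (ell2_dot u u))) ell2_dot_self. Qed.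

Lemma sqnorm_ge x u : sqabs (u x) <= sqnorm u.
Proof. by apply: (rsum_ge x _ (ell2P u)) => y; exact: sqabs_ge0. Qed.

Lemma sqnorm_ge0 u : 0 <= sqnorm u.
Proof.
suff: 0 <= dot u u by rewrite ell2_dot_self lecE /= => /andP[].
exact: dnorm_ge0.
Qed.

Lemma ell2_dotDl u v w : dot (u + v) w = dot u w + dot v w.
Proof. exact: linearDl. Qed.
Lemma ell2_dotDr u v w : dot u (v + w) = dot u v + dot u w.
Proof. exact: linearDr. Qed.
Lemma ell2_dotBl u v w : dot (u - v) w = dot u w - dot v w.
Proof. exact: linearBl. Qed.
Lemma ell2_dotBr u v w : dot u (v - w) = dot u v - dot u w.
Proof. exact: linearBr. Qed.
Lemma ell2_dotZl c u v : dot (c *: u) v = c * dot u v.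
Proof. exact: linearZl_LR. Qed.
Lemma ell2_dotZr c u v : dot u (c *: v) = Num.conj c * dot u v.
Proof. exact: linearZr_LR. Qed.

Lemma ell2_cauchy_schwarz u v : sqabs (dot u v) <= sqnorm u * sqnorm v.
Proof.
have [v0|vn0] := eqVneq (sqnorm v) 0.
  have -> : v = 0.
    apply/eqP; apply: contraT => /(ell2_dot_gt0) /=.
    by rewrite ell2_dot_self v0 ltxx.
  rewrite [dot u 0]linear0r /sqabs /= expr0n addr0.
  by rewrite mulr_ge0 ?sqnorm_ge0.
have vp : 0 < sqnorm v by rewrite lt_neqAle eq_sym vn0 sqnorm_ge0.
set d := dot u v; pose c : C := Complex (sqnorm v) 0.
(* This vector is [sqnorm v] times the component of u orthogonal to v. *)
have := sqnorm_ge0 (c *: u - d *: v).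
have -> : sqnorm (c *: u - d *: v) = sqnorm v * (sqnorm v * sqnorm u - sqabs d).
  have -> : sqnorm (c *: u - d *: v) = complex.Re (dot (c *: u - d *: v) (c *: u - d *: v)).
    by rewrite ell2_dot_self.
  rewrite !(ell2_dotBl, ell2_dotBr, ell2_dotZl, ell2_dotZr) !ell2_dot_self.
  rewrite (ell2_dotC v u) -/d /c !conjCE /sqabs; case: d => a b /=; ring.
by rewrite pmulr_rge0 // subr_ge0 mulrC.
Qed.

Lemma ell2_ext u v : (forall x, u x = v x) -> u = v.
Proof. by move=> uv; apply: val_inj; apply/funext. Qed.

Lemma ell2E_add u v x : (u + v) x = u x + v x. Proof. by []. Qed.
Lemma ell2E_opp u x : (- u) x = - u x. Proof. by []. Qed.
Lemma ell2E_scale c u x : (c *: u) x = c * u x. Proof. by []. Qed.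
Lemma ell2E_sum (I : Type) (s : seq I) (F : I -> ell2 R T) x :
  (\sum_(i <- s) F i) x = \sum_(i <- s) F i x.
Proof. exact: (big_morph (fun u : ell2 R T => u x)). Qed.

Lemma delta_subproof x : sq_summable (fun y => (y == x)%:R : C).
Proof.
rewrite /sq_summable /summableR /summable.
rewrite (eq_esum (b := fun y => (sqabs ((y == x)%:R : C))%:E)); last first.
  by move=> y _ /=; rewrite ger0_norm ?sqabs_ge0.
rewrite (@esum_support1 (fun y => sqabs ((y == x)%:R : C)) x) ?ltry //.
  by move=> y; exact: sqabs_ge0.
by move=> y /negPf ->; rewrite /sqabs /= expr0n addr0.
Qed.

Definition delta x : ell2 R T := Ell2 (delta_subproof x).

Lemma deltaE x y : delta x y = (y == x)%:R. Proof. by []. Qed.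

Lemma ell2_dot_deltar u x : dot u (delta x) = u x.
Proof.
rewrite /ell2_dot /csum (@rsum_support1 _ x) ?(@rsum_support1 _ x) => [|y|y].
- by rewrite deltaE eqxx rmorph1 mulr1; case: (u x).
- by rewrite deltaE => /negPf ->; rewrite rmorph0 mulr0.
- by rewrite deltaE => /negPf ->; rewrite rmorph0 mulr0.
Qed.

Lemma ell2_dot_deltal u x : dot (delta x) u = Num.conj (u x).
Proof. by rewrite ell2_dotC ell2_dot_deltar. Qed.

Definition truncation (s : seq T) f : ell2 R T := \sum_(x <- s) f x *: delta x.

Lemma truncationE (s : seq T) f y : uniq s ->
  truncation s f y = if y \in s then f y else 0.
Proof.
move=> us; rewrite /truncation ell2E_sum.
under eq_bigr do rewrite ell2E_scale deltaE.
case: ifP => ys; last first.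
  rewrite big_seq big1 // => x xs; case: eqP => [yx|]; last by rewrite mulr0.
  by rewrite yx xs in ys.
rewrite (bigD1_seq y) //= eqxx mulr1 big1 ?addr0 // => x xy.
by rewrite eq_sym (negPf xy) mulr0.
Qed.

Lemma ell2_dot_truncationl (s : seq T) f v :
  dot (truncation s f) v = \sum_(x <- s) f x * Num.conj (v x).
Proof.
rewrite /truncation linear_sumlz /=.
by under eq_bigr do rewrite ell2_dotZl ell2_dot_deltal.
Qed.

Lemma sum_sqabs (s : seq T) f :
  \sum_(x <- s) f x * Num.conj (f x) = Complex (\sum_(x <- s) sqabs (f x)) 0.
Proof.
under eq_bigr do rewrite mulCconj.
by elim/big_rec2: _ => // x a b _ ->; congr Complex; rewrite /= ?addr0.
Qed.

Lemma sqnorm_truncation (s : seq T) f : uniq s ->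
  sqnorm (truncation s f) = \sum_(x <- s) sqabs (f x).
Proof.
move=> us; have := ell2_dot_self (truncation s f).
have -> : dot (truncation s f) (truncation s f) = \sum_(x <- s) f x * Num.conj (f x).
  rewrite ell2_dot_truncationl !big_seq; apply: eq_bigr => x xs.
  by rewrite truncationE // xs.
by rewrite sum_sqabs => -[].
Qed.

Lemma truncation_approx u (e : R) : 0 < e ->
  exists2 s : seq T, uniq s & sqnorm (u - truncation s u) < e.
Proof.
move=> e0; have := rsum_approx (fun x => sqabs_ge0 (u x)) (ell2P u) e0.
move=> [s us lt]; exists s => //.
set t := truncation s u.
have tu : dot t u = Complex (\sum_(x <- s) sqabs (u x)) 0.
  by rewrite /t ell2_dot_truncationl sum_sqabs.
have tt : dot t t = dot t u by rewrite ell2_dot_self sqnorm_truncation.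
have : dot (u - t) (u - t) = Complex (sqnorm u - \sum_(x <- s) sqabs (u x)) 0.
  rewrite !(ell2_dotBl, ell2_dotBr) tt (ell2_dotC u t) tu ell2_dot_self conjCE /=.
  by congr Complex; rewrite /=; ring.
rewrite ell2_dot_self => -[->]; rewrite -/(sqnorm u) in lt; lra.
Qed.

Lemma sqabsM (a b : C) : sqabs (a * b) = sqabs a * sqabs b.
Proof. by case: a b => [a1 a2] [b1 b2]; rewrite /sqabs /=; ring. Qed.

Lemma sqabsD_le (a b : C) : sqabs (a + b) <= 2 * sqabs a + 2 * sqabs b.
Proof.
case: a b => [a1 a2] [b1 b2]; rewrite /sqabs /=.
have := sqr_ge0 (a1 - b1); have := sqr_ge0 (a2 - b2); nra.
Qed.

Lemma sqabsN (a : C) : sqabs (- a) = sqabs a.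
Proof. by case: a => a b; rewrite /sqabs /= !sqrrN. Qed.

Lemma sqabs_eq0 (a : C) : sqabs a = 0 -> a = 0.
Proof.
move=> /eqP; rewrite /sqabs paddr_eq0 ?sqr_ge0 // !sqrf_eq0.
by case: a => a b /= /andP[/eqP -> /eqP ->].
Qed.

Lemma sqnormZ c u : sqnorm (c *: u) = sqabs c * sqnorm u.
Proof.
have := ell2_dot_self (c *: u); rewrite ell2_dotZl ell2_dotZr mulrA mulCconj ell2_dot_self.
by move=> [<- _]; rewrite /=; ring.
Qed.

Lemma sqnorm_parallelogram u v :
  sqnorm (u + v) + sqnorm (u - v) = 2 * sqnorm u + 2 * sqnorm v.
Proof.
have E w : sqnorm w = complex.Re (dot w w) by rewrite ell2_dot_self.
rewrite !E !(ell2_dotBl, ell2_dotBr, ell2_dotDl, ell2_dotDr).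
by move: (dot u u) (dot u v) (dot v u) (dot v v) => [a ?] [b ?] [c ?] [d ?] /=; ring.
Qed.

Lemma sqnormD_le u v : sqnorm (u + v) <= 2 * sqnorm u + 2 * sqnorm v.
Proof. by rewrite -sqnorm_parallelogram lerDl sqnorm_ge0. Qed.

(** * Bounded operators and their adjoints *)

Section Operators.
Implicit Types A B : ell2 R T -> ell2 R T.
Local Notation bounded := (bounded_operator dot).

(** Squared norms keep square roots out of the later estimates. *)
Lemma boundedP A : bounded A <->
  linear A /\ exists2 K : R, 0 <= K & forall v, sqnorm (A v) <= K * sqnorm v.
Proof.
split=> -[linA].
  move=> [c Ac]; split=> //; exists (c ^+ 2) => [|v]; first exact: sqr_ge0.
  have := Ac v; rewrite !hnormE => le.
  rewrite -[leLHS]sqr_sqrtr ?sqnorm_ge0 // -[X in _ * X]sqr_sqrtr ?sqnorm_ge0 //.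
  rewrite -exprMn ler_sqr ?nnegrE ?sqrtr_ge0 //; apply: le_trans le.
  exact: sqrtr_ge0.
move=> [K K0 AK]; split=> //; exists (Num.sqrt K) => v.
by rewrite !hnormE -sqrtrM // ler_wsqrtr.
Qed.

Lemma bounded_linear A : bounded A -> linear A. Proof. by case. Qed.

Lemma linear_opZ A c v : linear A -> A (c *: v) = c *: A v.
Proof.
move=> linA.
pose A' : {linear ell2 R T -> ell2 R T} := HB.pack A (GRing.isLinear.Build _ _ _ _ A linA).
exact: (linearZ_LR A').
Qed.

Lemma linear_opD A u v : linear A -> A (u + v) = A u + A v.
Proof. by move=> linA; have := linA 1 u v; rewrite !scale1r. Qed.

Lemma linear_opB A u v : linear A -> A (u - v) = A u - A v.
Proof. by move=> linA; have := linA (-1) v u; rewrite !scaleN1r ![- _ + _]addrC. Qed.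

Lemma linear_op_truncation A (s : seq T) f : linear A ->
  A (truncation s f) = \sum_(x <- s) f x *: A (delta x).
Proof.
move=> linA.
pose A' : {linear ell2 R T -> ell2 R T} := HB.pack A (GRing.isLinear.Build _ _ _ _ A linA).
rewrite [LHS](linear_sum A'); apply: eq_bigr => x _; exact: linear_opZ.
Qed.

Lemma bounded_comp A B : bounded A -> bounded B -> bounded (A \o B).
Proof.
move=> /boundedP[linA [K K0 AK]] /boundedP[linB [L L0 BL]]; apply/boundedP; split.
  by move=> c u v /=; rewrite linB linA.
exists (K * L) => [|v]; first exact: mulr_ge0.
by apply: le_trans (AK _) _; rewrite -mulrA ler_wpM2l.
Qed.

Lemma bounded_lincomb a b A B : bounded A -> bounded B ->
  bounded (fun v => a *: A v + b *: B v).
Proof.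
move=> /boundedP[linA [K K0 AK]] /boundedP[linB [L L0 BL]]; apply/boundedP; split.
  move=> c u v; rewrite linA linB !scalerDr !scalerA ![_ * c]mulrC.
  by rewrite addrACA.
exists (2 * sqabs a * K + 2 * sqabs b * L) => [|v].
  by rewrite addr_ge0 // !mulr_ge0 // sqabs_ge0.
apply: le_trans (sqnormD_le _ _) _; rewrite !sqnormZ.
have -> : (2 * sqabs a * K + 2 * sqabs b * L) * sqnorm v =
    2 * (sqabs a * (K * sqnorm v)) + 2 * (sqabs b * (L * sqnorm v)) by ring.
by apply: lerD; rewrite ler_wpM2l // ler_wpM2l ?sqabs_ge0.
Qed.

Lemma bounded_isometry A : linear A -> (forall v, sqnorm (A v) = sqnorm v) -> bounded A.
Proof.
by move=> linA iA; apply/boundedP; split=> //; exists 1 => // v; rewrite iA mul1r.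
Qed.

(** The adjoint is given by its coordinates, the products of v with [A (delta x)]. Their
    square-summability is a bound on finite sums; the adjoint relation is clear on truncations and
    follows in general by approximation. *)
Lemma adjoint_exists A : bounded A -> exists2 B, bounded B & adjoint_to dot A B.
Proof.
move=> /boundedP[linA [K K0 AK]].
pose f v x : C := dot v (A (delta x)).
have fbound v (s : seq T) : uniq s -> \sum_(x <- s) sqabs (f v x) <= K * sqnorm v.
  move=> us; set S := \sum_(x <- s) _.
  have S0 : 0 <= S by apply: sumr_ge0 => x _; exact: sqabs_ge0.
  (* S is the product with v of the image under A of the truncated family [f v], whose squared norm
     is again S. Cauchy-Schwarz gives the bound, and S can then be cancelled. *)
  have : S ^+ 2 <= K * S * sqnorm v.
    have -> : S ^+ 2 = sqabs (dot (A (truncation s (f v))) v).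
      rewrite linear_op_truncation // linear_sumlz /=.
      under eq_bigr do rewrite ell2_dotZl (ell2_dotC (A _)) -/(f v _).
      by rewrite sum_sqabs -/S /sqabs /= expr0n addr0.
    apply: le_trans (ell2_cauchy_schwarz _ _) _.
    rewrite ler_wpM2r ?sqnorm_ge0 //; apply: le_trans (AK _) _.
    by rewrite sqnorm_truncation.
  have [->|Sn0] := eqVneq S 0; first by rewrite mulr_ge0 ?sqnorm_ge0.
  have Sp : 0 < S by rewrite lt_neqAle eq_sym Sn0.
  by rewrite expr2 mulrAC ler_pM2r.
have fB v := rsum_fset_bound (fun x => sqabs_ge0 (f v x)) (fbound v).
pose B v : ell2 R T := Ell2 (proj1 (fB v) : sq_summable (f v)).
have BK v : sqnorm (B v) <= K * sqnorm v := proj2 (fB v).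
exists B.
  apply/boundedP; split; last by exists K.
  move=> c u v; apply: ell2_ext => x.
  by rewrite ell2E_add ell2E_scale /= /f ell2_dotDl ell2_dotZl.
move=> u v; apply/eqP; rewrite -subr_eq0; apply/eqP/sqabs_eq0.
set D := _ - _.
pose M := 2 * (K * sqnorm v) + 2 * sqnorm (B v).
have M0 : 0 <= M by rewrite addr_ge0 // !mulr_ge0 ?sqnorm_ge0.
have small e : 0 < e -> sqabs D <= e * M.
  move=> e0; have [s us lt] := truncation_approx u e0.
  set t := truncation s u in lt.
  have tE : dot (A t) v = dot t (B v).
    rewrite /t linear_op_truncation // linear_sumlz ell2_dot_truncationl.
    by apply: eq_bigr => x _; rewrite /= ell2_dotZl /f -ell2_dotC.
  have -> : D = dot (A (u - t)) v - dot (u - t) (B v).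
    by rewrite linear_opB // !ell2_dotBl tE /D opprB addrA subrK.
  apply: le_trans (sqabsD_le _ _) _; rewrite sqabsN.
  have := ell2_cauchy_schwarz (A (u - t)) v.
  have := ell2_cauchy_schwarz (u - t) (B v).
  have := AK (u - t); rewrite /M.
  have := sqnorm_ge0 v; have := sqnorm_ge0 (B v).
  move: (sqabs (dot _ _)) (sqabs (dot _ _)) (sqnorm (A _)) (sqnorm v) (sqnorm (B v)) lt.
  move: (sqnorm _) => n p q a b c ne b0 c0 ak h1 h2.
  have : n * c <= e * c by rewrite ler_wpM2r // ltW.
  have : a * b <= K * n * b by rewrite ler_wpM2r.
  have : K * n * b <= K * e * b by rewrite ler_wpM2r // ler_wpM2l // ltW.
  nra.
apply/eqP; apply: contraT => Dn0.
have Dp : 0 < sqabs D by rewrite lt_neqAle eq_sym Dn0 sqabs_ge0.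
have M1 : 0 < M + 1 by lra.
have := small (sqabs D / (M + 1)) (divr_gt0 Dp M1).
rewrite mulrAC ler_pdivlMr // mulrDr mulr1; lra.
Qed.

Lemma adjoint_toE A B u v : adjoint_to dot A B -> dot (A u) v = dot u (B v).
Proof. by move=> AB; exact: AB. Qed.

Lemma adjoint_to_sym A B : adjoint_to dot A B -> adjoint_to dot B A.
Proof.
move=> AB u v; rewrite -[LHS]/(dot (B u) v) ell2_dotC -(adjoint_toE _ _ AB).
by rewrite -ell2_dotC.
Qed.

Lemma adjoint_delta A B x y : adjoint_to dot A B -> B (delta y) x = Num.conj (A (delta x) y).
Proof.
move=> AB; rewrite -(ell2_dot_deltar (B _)) -(ell2_dot_deltal _ y).
by rewrite ell2_dotC -(adjoint_toE _ _ AB) -ell2_dotC.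
Qed.

(** Values on the basis fix the coordinates of the adjoint on each [delta y], and these in turn give
    every coordinate of [A u]. *)
Lemma bounded_ext A B : bounded A -> bounded B ->
  (forall x, A (delta x) = B (delta x)) -> A = B.
Proof.
move=> bA bB AB; have [A' _ AA'] := adjoint_exists bA.
have [B' _ BB'] := adjoint_exists bB.
apply/funext => u; apply: ell2_ext => y.
rewrite -!(ell2_dot_deltar _ y) (adjoint_toE _ _ AA') (adjoint_toE _ _ BB'); congr (dot u _).
by apply: ell2_ext => x; rewrite (adjoint_delta _ _ AA') (adjoint_delta _ _ BB') AB.
Qed.

End Operators.

(** * Vectors of nearly minimal norm *)

Lemma sqabs_superlevel_finite u (e : R) : 0 < e -> finite_set [set x | e <= sqabs (u x)].
Proof.
move=> e0; have [s us lt] := truncation_approx u e0.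
apply: (@sub_finite_set _ _ [set` s]); last exact: finite_seq.
move=> x /= ex; apply: contraT => xs.
have := le_lt_trans (sqnorm_ge x _) lt.
by rewrite ell2E_add ell2E_opp truncationE // (negPf xs) subr0 ltNge ex.
Qed.

Lemma sqnorm_delta x : sqnorm (delta x) = 1.
Proof.
have := ell2_dot_self (delta x); rewrite ell2_dot_deltar deltaE eqxx.
by move=> [<-].
Qed.

(* By the parallelogram law, elements of V of nearly minimal norm are nearly
   invariant under Phi, hence nearly zero on the infinite orbits. *)
Lemma orthogonal_vanish (V : set (ell2 R T)) (Phi : set (T -> T)) c g :
  V !=set0 -> (forall u, V u -> u g = 1) ->
  (forall u v, V u -> V v -> V (2^-1 *: u + 2^-1 *: v)) ->
  (forall phi u, Phi phi -> V u ->
     exists v, [/\ V v, forall x, v x = u (phi x) & sqnorm v = sqnorm u]) ->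
  (forall x, x != g -> ~ finite_set [set phi x | phi in Phi]) ->
  (forall u, V u -> dot u c = 0) -> c g = 0.
Proof.
move=> [u0 Vu0] Vg Vmid Vphi orb Vc.
pose S := [set sqnorm u | u in V]; pose D := inf S.
have hS : has_inf S.
  by split; [exists (sqnorm u0), u0|exists 0 => _ [u _ <-]; exact: sqnorm_ge0].
have D0 : 0 <= D by apply: lb_le_inf => [|_ [u _ <-]]; [case: hS|exact: sqnorm_ge0].
have DV u : V u -> D <= sqnorm u by move=> Vu; apply: ge_inf; [case: hS|exists u].
have near_min e : 0 < e -> exists2 u, V u & sqnorm u < D + e.
  by move=> e0; have [_ [u Vu <-]] := inf_adherent e0 hS; exists u.
(* The midpoint of u and its reindexed copy v lies in V, so the parallelogram law gives sqnorm (u -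
   v) < 4 * e. With phi x chosen where u has squared modulus below e, the bound is 2 * (4 * e) + 2 *
   e. *)
have flat e u : 0 < e -> V u -> sqnorm u < D + e ->
    forall x, x != g -> sqabs (u x) <= 10 * e.
  move=> e0 Vu ue x xg.
  have [phi Pphi small] : exists2 phi, Phi phi & sqabs (u (phi x)) < e.
    apply: contrapT => H; apply: (orb x xg).
    apply: sub_finite_set (sqabs_superlevel_finite u e0) => _ [phi Pphi <-] /=.
    by rewrite leNgt; apply/negP => lt; apply: H; exists phi.
  have [v [Vv vE vn]] := Vphi _ _ Pphi Vu.
  have mid : 4 * D <= sqnorm (u + v).
    have := DV _ (Vmid _ _ Vu Vv); rewrite -scalerDr sqnormZ.
    have : sqabs (2^-1 : C) * sqabs (2 : C) = sqabs (1 : C).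
      by rewrite -sqabsM mulVf // pnatr_eq0.
    rewrite [sqabs 2]/sqabs [sqabs 1]/sqabs /=.
    move: (sqabs _) => q; have := sqnorm_ge0 (u + v); nra.
  have uv := sqnorm_parallelogram u v; rewrite vn in uv.
  have := sqnorm_ge x (u - v); rewrite ell2E_add ell2E_opp vE => le.
  have := sqabsD_le (u x - u (phi x)) (u (phi x)); rewrite subrK.
  lra.
apply: contrapT => cg0.
have K0 : 0 < sqabs (c g).
  by rewrite lt_neqAle sqabs_ge0 andbT eq_sym; apply/eqP => /sqabs_eq0.
(* The product of w = u - delta g with c has squared modulus K. After splitting c into t and c - t,
   the constants below make each part contribute at most K / 4, whence K <= K / 2. *)
set K := sqabs (c g) in K0.
pose W := 2 * (D + 1) + 2.
have W0 : 0 < W by rewrite /W; lra.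
have e1_gt0 : 0 < K / (8 * W) by rewrite divr_gt0 // mulr_gt0.
have [s us sc] := truncation_approx c e1_gt0.
set t := truncation s c in sc.
pose B := 20 * (size s)%:R * sqnorm c.
have B0 : 0 <= B by rewrite !mulr_ge0 ?sqnorm_ge0 ?ler0n.
have Z0 : 0 < 4 * (B + K + 1) by lra.
pose e := K / (4 * (B + K + 1)).
have e0 : 0 < e by rewrite divr_gt0.
have e1 : e <= 1 by rewrite ler_pdivrMr //; lra.
have eB : e * B <= K / 4.
  rewrite /e mulrAC ler_pdivrMr // mulrAC ler_pdivlMr //; nra.
have [u Vu ue] := near_min e e0.
pose w := u - delta g.
have wn : sqnorm w <= W.
  apply: le_trans (sqnormD_le _ _) _.
  have -> : sqnorm (- delta g) = 1 by rewrite -scaleN1r sqnormZ sqabsN sqnorm_delta /sqabs /=; ring.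
  rewrite /W; lra.
have wx x : sqabs (w x) <= 10 * e.
  rewrite /w ell2E_add ell2E_opp deltaE; have [->|xg] := eqVneq x g.
    by rewrite (Vg _ Vu) subrr /sqabs /= expr0n addr0 mulr_ge0 // ltW.
  by rewrite subr0; exact: flat.
have cgE : dot w c = - Num.conj (c g).
  by rewrite /w ell2_dotBl (Vc _ Vu) ell2_dot_deltal sub0r.
have wt : sqabs (dot w t) <= (size s)%:R * (10 * e) * sqnorm c.
  (* The truncation is moved from c to w, whose values are uniformly small. *)
  have -> : dot w t = dot (truncation s w) c.
    rewrite ell2_dotC !ell2_dot_truncationl rmorph_sum /=.
    by apply: eq_bigr => x _; rewrite rmorphM /= conjCK mulrC.
  apply: le_trans (ell2_cauchy_schwarz _ _) _; rewrite ler_wpM2r ?sqnorm_ge0 //.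
  rewrite sqnorm_truncation //; apply: le_trans (ler_sum _ (fun x _ => wx x)) _.
  by rewrite big_const_seq count_predT iter_addr_0 -[leLHS]mulr_natl.
have wr : sqabs (dot w (c - t)) <= W * (K / (8 * W)).
  apply: le_trans (ell2_cauchy_schwarz _ _) _.
  exact: (ler_pM (sqnorm_ge0 _) (sqnorm_ge0 _) wn (ltW sc)).
have := sqabsD_le (dot w t) (dot w (c - t)).
rewrite -ell2_dotDr addrC subrK cgE sqabsN sqabs_conj -/K.
have WK : W * (K / (8 * W)) = K / 8 by field; rewrite gt_eqF.
rewrite WK in wr.
have : 2 * ((size s)%:R * (10 * e) * sqnorm c) = e * B by rewrite /B; ring.
move: (sqabs _) (sqabs _) wt wr => p q; lra.
Qed.

End Ell2Theory.

(** * Reindexing along bijections *)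

Section Reindexing.
Context {R : realType} {T : choiceType} (phi : T -> T) (bphi : bijective phi).

Lemma esum_bij (f : T -> \bar R) :
  (\esum_(x in [set: T]) f (phi x) = \esum_(x in [set: T]) f x)%E.
Proof.
by rewrite [RHS](@reindex_esum R T T [set: T] [set: T] phi) // setTT_bijective.
Qed.

Lemma rsum_bij (f : T -> R) : rsum (fun x => f (phi x)) = rsum f.
Proof.
by rewrite /rsum (esum_bij (fun x => (Num.max (f x) 0)%:E))
  (esum_bij (fun x => (Num.max (- f x) 0)%:E)).
Qed.

Lemma sq_summable_bij (f : T -> R[i]) : sq_summable f -> sq_summable (fun x => f (phi x)).
Proof.
rewrite /sq_summable /summableR /summable => sf.
by rewrite (esum_bij (fun x => `|(EFin \o (fun x => sqabs (f x))) x|%E)).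
Qed.

Lemma ell2_dot_bij (u v u' v' : ell2 R T) : (forall x, u' x = u (phi x)) ->
  (forall x, v' x = v (phi x)) -> ell2_dot u' v' = ell2_dot u v.
Proof.
move=> uE vE; rewrite /ell2_dot /csum.
congr Complex; rewrite -[RHS]rsum_bij; by apply: eq_rsum => x; rewrite uE vE.
Qed.

Lemma sqnorm_bij (u v : ell2 R T) : (forall x, v x = u (phi x)) -> sqnorm v = sqnorm u.
Proof.
move=> vE; rewrite /sqnorm -[RHS]rsum_bij.
by apply: eq_rsum => x; rewrite vE.
Qed.

End Reindexing.

Lemma ell2_dot_disjoint (R : realType) (T : choiceType) (u v : ell2 R T) :
  (forall x, u x = 0 \/ v x = 0) -> ell2_dot u v = 0.
Proof.
move=> uv; have z x : u x * Num.conj (v x) = 0.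
  by case: (uv x) => ->; rewrite ?mul0r // rmorph0 mulr0.
have r0 : rsum (fun _ : T => 0 : R) = 0.
  by rewrite /rsum; under eq_esum do rewrite maxxx;
     under [X in _ - fine X]eq_esum do rewrite oppr0 maxxx; rewrite subrr.
by rewrite /ell2_dot /csum; congr Complex; rewrite -[RHS]r0; apply: eq_rsum => x; rewrite z.
Qed.

(** * Commutants *)

Section Commutants.
Context {R : realType} {T : choiceType}.
Local Notation dot := (@ell2_dot R T).
Implicit Types X Y : set (ell2 R T -> ell2 R T).

Lemma commutantS X Y : X `<=` Y -> commutant dot Y `<=` commutant dot X.
Proof. by move=> XY A [bA cA]; split=> // B /XY; exact: cA. Qed.

Lemma sub_commutant2 X : X `<=` bounded_operator dot ->
  X `<=` commutant dot (commutant dot X).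
Proof. by move=> bX A XA; split=> [|B [_ cB]]; [exact: bX|rewrite cB]. Qed.

Lemma commutant3 X : X `<=` bounded_operator dot ->
  commutant dot (commutant dot (commutant dot X)) = commutant dot X.
Proof.
move=> bX; rewrite eqEsubset; split; first exact/commutantS/sub_commutant2.
by apply: sub_commutant2 => A [].
Qed.

Lemma commutant_comp X A B : commutant dot X A -> commutant dot X B ->
  commutant dot X (A \o B).
Proof.
move=> [bA cA] [bB cB]; split; first exact: bounded_comp.
by move=> S XS; rewrite -compA cB // compA cA.
Qed.

Lemma commutant_lincomb X a b A B : (X `<=` [set S | linear S]) ->
  commutant dot X A -> commutant dot X B ->
  commutant dot X (fun v => a *: A v + b *: B v).
Proof.
move=> lX [bA cA] [bB cB]; split; first exact: bounded_lincomb.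
move=> S XS; apply/funext => v /=; have lS : linear S := lX _ XS.
rewrite (linear_opD _ _ lS) !(linear_opZ _ _ lS).
by rewrite -[A (S v)]/((A \o S) v) -[B (S v)]/((B \o S) v) cA // cB.
Qed.

(** Take adjoints in A S' = S' A, where S' is the adjoint of S. *)
Lemma commutant_adjoint X A B :
  (forall S, X S -> exists2 S', X S' & adjoint_to dot S S') ->
  commutant dot X A -> bounded_operator dot B -> adjoint_to dot A B ->
  commutant dot X B.
Proof.
move=> adjX [bA cA] bB AB; split=> // S XS; have [S' XS' SS'] := adjX S XS.
have com u v : dot (S' (A u)) v = dot (A (S' u)) v.
  by rewrite -[S' (A u)]/((S' \o A) u) -cA.
have SS2 := adjoint_to_sym SS'.
apply/funext => v /=; apply: ell2_ext => y.
apply: (can_inj (@conjCK _)); rewrite -!ell2_dot_deltal.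
by rewrite -(adjoint_toE _ _ AB) -(adjoint_toE _ _ SS2) -(adjoint_toE _ _ SS2)
  -(adjoint_toE _ _ AB) com.
Qed.

End Commutants.

(** * Translations and Fourier coefficients *)

Section Translations.
Context {R : realType} {G : groupType}.
Local Notation dot := (@ell2_dot R G).
Local Notation lreg := (@left_regular R G).
Implicit Types (g h x y : G) (u v : ell2 R G) (A S : ell2 R G -> ell2 R G).

Lemma mulg_bij g : bijective (fun x => x * g)%g.
Proof. by exists (fun x => x * g^-1)%g => x; rewrite ?mulgK ?mulgVK. Qed.

Lemma mulg_bijl g : bijective (fun x => g * x)%g.
Proof. by exists (fun x => g^-1 * x)%g => x; rewrite ?mulKg ?mulVKg. Qed.

Lemma invg_bij : bijective (fun x : G => x^-1)%g.
Proof. by exists (fun x => x^-1)%g => x; rewrite invgK. Qed.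

Definition right_regular g u : ell2 R G := Ell2 (sq_summable_bij (mulg_bij g) (ell2P u)).

Lemma ell2_flip_subproof u : sq_summable (fun x => Num.conj (u x^-1%g)).
Proof.
have := sq_summable_bij invg_bij (ell2P u).
rewrite /sq_summable; congr (summableR _); apply/funext => x.
by rewrite sqabs_conj.
Qed.

(** The modular conjugation J of L(G): it is antiunitary and, for a bounded equivariant operator,
    exchanges the Fourier vectors of the operator and of its adjoint. *)
Definition ell2_flip u : ell2 R G := Ell2 (ell2_flip_subproof u).

Lemma ell2_dot_flip u v : dot (ell2_flip u) (ell2_flip v) = dot v u.
Proof.
rewrite -(ell2_dot_bij invg_bij (u := v) (v := u)
  (u' := Ell2 (sq_summable_bij invg_bij (ell2P v)))
  (v' := Ell2 (sq_summable_bij invg_bij (ell2P u)))) //.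
by congr csum; apply/funext => x /=; rewrite conjCK mulrC.
Qed.

Lemma left_regular_linear g : linear (lreg g).
Proof. by move=> c u v; apply: ell2_ext. Qed.

Lemma right_regular_linear g : linear (right_regular g).
Proof. by move=> c u v; apply: ell2_ext. Qed.

Lemma left_regular_sqnorm g u : sqnorm (lreg g u) = sqnorm u.
Proof. exact: (sqnorm_bij (mulg_bijl g^-1%g)). Qed.

Lemma right_regular_sqnorm g u : sqnorm (right_regular g u) = sqnorm u.
Proof. exact: (sqnorm_bij (mulg_bij g)). Qed.

Lemma left_regular_bounded g : bounded_operator dot (lreg g).
Proof. exact: bounded_isometry (left_regular_linear g) (left_regular_sqnorm g). Qed.

Lemma right_regular_bounded g : bounded_operator dot (right_regular g).
Proof. exact: bounded_isometry (right_regular_linear g) (right_regular_sqnorm g). Qed.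

Lemma left_regularM g h : lreg (g * h)%g = lreg g \o lreg h.
Proof. by apply/funext => u; apply: ell2_ext => x /=; rewrite invgM mulgA. Qed.

Lemma left_regular_delta g x : lreg g (delta x) = delta (g * x)%g.
Proof.
apply: ell2_ext => y /=; congr (_%:R); congr nat_of_bool.
by apply/eqP/eqP => [<-|->]; rewrite ?mulVKg ?mulKg.
Qed.

Lemma right_regular_delta g x : right_regular g (delta x) = delta (x * g^-1)%g.
Proof.
apply: ell2_ext => y /=; congr (_%:R); congr nat_of_bool.
by apply/eqP/eqP => [<-|->]; rewrite ?mulgVK ?mulgK.
Qed.

Lemma left_right_regular g h : lreg g \o right_regular h = right_regular h \o lreg g.
Proof. by apply/funext => u; apply: ell2_ext => x /=; rewrite mulgA. Qed.

Lemma left_regular_adjoint g : adjoint_to dot (lreg g) (lreg g^-1%g).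
Proof.
move=> u v; rewrite -[LHS]/(dot (lreg g u) v) -[RHS]/(dot u (lreg g^-1%g v)).
rewrite -[RHS](ell2_dot_bij (mulg_bijl g^-1%g) (u' := lreg g u) (v' := v)) //.
by move=> x /=; rewrite invgK mulVKg.
Qed.

Definition equivariant A := forall g, A \o right_regular g = right_regular g \o A.

(** The vector [A (delta 1%g)] is thus the family of Fourier coefficients of [A] and determines
    every matrix entry. *)
Lemma equivariant_delta A x z : equivariant A -> A (delta x) z = A (delta 1%g) (z * x^-1)%g.
Proof.
move=> eA; have -> : delta x = right_regular x^-1%g (delta 1%g) :> ell2 R G.
  by rewrite right_regular_delta invgK mul1g.
by rewrite -[A _]/((A \o right_regular _) _) eA.
Qed.

(** Makes commutation with S a linear condition on Fourier vectors. The conjugate of [c h] is one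
    matrix entry of the commutator of S with the translation by h, and the product with c extends
    this entry from translations to all [A]. *)
Lemma commutator_coefficient S x y : bounded_operator dot S ->
  exists c : ell2 R G,
    (forall h, c h = Num.conj (S (delta (h * x)%g) y) - Num.conj (S (delta x) (h^-1 * y)%g)) /\
    forall A, bounded_operator dot A -> equivariant A ->
      dot (A (delta 1%g)) c = S (A (delta x)) y - A (S (delta x)) y.
Proof.
move=> bS; have [S' _ SS'] := adjoint_exists bS.
exists (right_regular x (S' (delta y)) - ell2_flip (right_regular y (S (delta x)))).
split=> [h|A bA eA].
  rewrite ell2E_add ell2E_opp; congr (_ - _).
  by rewrite [LHS](adjoint_delta _ _ SS').
have [A' _ AA'] := adjoint_exists bA.
rewrite ell2_dotBr; congr (_ - _).
  rewrite -[RHS]ell2_dot_deltar (adjoint_toE _ _ SS').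
  apply: (ell2_dot_bij (mulg_bij x)) => // z.
  by rewrite (equivariant_delta _ _ eA) mulgK.
(* The flip turns the product into one with the adjoint [A'], from which A reappears applied to
   [S (delta x)]. *)
have -> : A (delta 1%g) = ell2_flip (A' (delta 1%g)).
  apply: ell2_ext => z /=; rewrite (adjoint_delta _ _ AA') conjCK.
  by rewrite (equivariant_delta _ _ eA) invgK mul1g.
rewrite ell2_dot_flip -(adjoint_toE _ _ AA') ell2_dot_deltar.
rewrite -[A (right_regular _ _)]/((A \o right_regular _) _) eA /=.
by rewrite mul1g.
Qed.

End Translations.

(** * Algebras between L(N x| Qm) and L(N x| Q) *)

Section GroupVonNeumann.
Context {R : realType} {G : groupType}.
Local Notation dot := (@ell2_dot R G).
Local Notation lreg := (@left_regular R G).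
Local Notation vN := (@group_vN R G).
Implicit Types (g h x y : G) (H K : set G).

Lemma translations_bounded H : [set lreg h | h in H] `<=` bounded_operator dot.
Proof. by move=> _ [h _ <-]; exact: left_regular_bounded. Qed.

Lemma group_vN_von_neumann H : subgroup H -> von_neumann_algebra dot (vN H).
Proof.
move=> [_ _ HV]; split; first by move=> A [].
- move=> A B vA bB AB; apply: commutant_adjoint vA bB AB => S [bS cS].
  have [S' bS' SS'] := adjoint_exists bS; exists S' => //.
  apply: commutant_adjoint bS' SS'; last by split.
  move=> _ [h Hh <-]; exists (lreg h^-1%g); last exact: left_regular_adjoint.
  by exists h^-1%g => //; exact: HV.
- apply: commutant3 => A; case=> //.
Qed.

Lemma group_vN_translation H h : H h -> vN H (lreg h).
Proof. by move=> Hh; apply: (sub_commutant2 (@translations_bounded H)); exists h. Qed.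

Lemma group_vNS H K : H `<=` K -> vN H `<=` vN K.
Proof.
move=> HK; apply/commutantS/commutantS => _ [h Hh <-].
by exists h => //; exact: HK.
Qed.

Lemma group_vN_equivariant A : vN [set: G] A -> equivariant A.
Proof.
move=> [_ cA] g; apply: cA; split; first exact: right_regular_bounded.
by move=> _ [h _ <-]; rewrite left_right_regular.
Qed.

(** For S commuting with the translations by H, the vector c of [commutator_coefficient] vanishes on
    H, while the Fourier vector of A vanishes off H; the two are orthogonal, so S commutes with
    A. *)
Lemma group_vN_support H A : vN [set: G] A ->
  (forall g, ~ H g -> A (delta 1%g) g = 0) -> vN H A.
Proof.
move=> vA suppA; have eA := group_vN_equivariant vA.
have bA : bounded_operator dot A by case: vA.
split=> // S [bS cS]; apply: bounded_ext => [||x]; try exact: bounded_comp.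
apply: ell2_ext => y; have [c [cE cA]] := commutator_coefficient x y bS.
apply/esym/eqP; rewrite -subr_eq0 -cA //; apply/eqP/ell2_dot_disjoint => h.
have [Hh|nHh] := pselect (H h); last by left; exact: suppA.
right; rewrite cE -left_regular_delta.
rewrite -[S (lreg h _)]/((S \o lreg h) _) cS; last by exists h.
by rewrite /= subrr.
Qed.

Lemma von_neumann_comp P A B : von_neumann_algebra dot P -> P A -> P B -> P (A \o B).
Proof. by move=> [_ _ <-]; exact: commutant_comp. Qed.

Lemma von_neumann_lincomb P a b A B : von_neumann_algebra dot P -> P A -> P B ->
  P (fun v => a *: A v + b *: B v).
Proof.
move=> [_ _ <-]; apply: commutant_lincomb => S [bS _].
exact: bounded_linear.
Qed.

Lemma von_neumann_translationV P g : von_neumann_algebra dot P ->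
  P (lreg g) -> P (lreg g^-1%g).
Proof.
move=> [_ adj _] Pg; apply: adj Pg (left_regular_bounded _) _.
exact: left_regular_adjoint.
Qed.

Lemma group_vN_min P H : von_neumann_algebra dot P ->
  (forall h, H h -> P (lreg h)) -> vN H `<=` P.
Proof.
move=> [_ _ PE] HP; rewrite -PE; apply/commutantS/commutantS.
by move=> _ [h Hh <-]; exact: HP.
Qed.

(* An element T of P and its conjugates by the twisted translations
   lreg n \o T \o lreg (g^-1 n^-1 g) have the same g-th Fourier coefficient. As
   the twisted orbits off g are infinite, averaging isolates this coefficient. *)
Lemma intermediate_translation (K H : set G) P A g :
  (forall n, K n -> K n^-1%g) -> (forall x n, K n -> H (x^-1 * n * x)%g) ->
  (forall x, x <> 1%g -> ~ finite_set [set (n * x * n^-1)%g | n in K]) ->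
  von_neumann_algebra dot P -> vN H `<=` P -> P `<=` vN [set: G] ->
  P A -> A (delta 1%g) g <> 0 -> P (lreg g).
Proof.
move=> KV KH icc vP HP PG PA Ag.
(* By the bicommutant property it suffices that [lreg g] commutes with every S in the commutant of
   P; entrywise this is the vanishing of [c g]. *)
have [_ _ PE] := vP; rewrite -PE.
split=> [|S [bS cS]]; first exact: left_regular_bounded.
have bP B : P B -> bounded_operator dot B by case: vP => + _ _; apply.
have eP B : P B -> equivariant B by move=> /PG; exact: group_vN_equivariant.
apply: bounded_ext => [||x]; try exact: bounded_comp (left_regular_bounded _) bS.
  exact: bounded_comp bS (left_regular_bounded _).
apply: ell2_ext => y; have [c [cE cA]] := commutator_coefficient x y bS.
suff : c g = 0.
  rewrite cE => /eqP; rewrite subr_eq0 => /eqP/(can_inj (@conjCK _)).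
  by rewrite /= left_regular_delta => ->.
pose V : set (ell2 R G) :=
  [set u | exists B, [/\ P B, u = B (delta 1%g) & u g = 1]].
pose twist n : G -> G := fun z => (n * z * (g^-1 * n^-1 * g))%g.
apply: (@orthogonal_vanish _ _ V [set twist n | n in K]).
- exists ((A (delta 1%g) g)^-1 *: A (delta 1%g)).
  exists (fun v => (A (delta 1%g) g)^-1 *: A v + 0 *: A v); split.
  + exact: von_neumann_lincomb.
  + by rewrite scale0r addr0.
  + by rewrite ell2E_scale mulVf //; apply/eqP.
- by move=> u [B []].
- move=> u v [B [PB -> Bg]] [B' [PB' -> Bg']].
  exists (fun w => 2^-1 *: B w + 2^-1 *: B' w); split=> //.
    exact: von_neumann_lincomb.
  rewrite ell2E_add !ell2E_scale Bg Bg' !mulr1.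
  by rewrite [RHS](splitr 1) !mul1r.
- move=> _ _ [n Kn <-] [B [PB -> Bg]].
  (* Multiplying B on both sides by translations lying in P precomposes its Fourier vector with
     [twist n], which fixes g. *)
  pose m := (g^-1 * n * g)%g.
  pose B' := (lreg n^-1 \o B) \o lreg m.
  have B'E z : B' (delta 1%g) z = B (delta 1%g) (twist n z).
    rewrite /B' /= left_regular_delta mulg1 (equivariant_delta _ _ (eP _ PB)).
    by rewrite invgK /m !invgM invgK /twist !mulgA.
  exists (B' (delta 1%g)); split=> //.
  + exists B'; split=> //.
      apply: von_neumann_comp => //; [apply: von_neumann_comp => //|];
        apply/HP/group_vN_translation.
        by have := KH 1%g _ (KV _ Kn); rewrite invg1 mul1g mulg1.
      exact: KH.
    by rewrite B'E /twist !mulgA mulgK mulgV mul1g.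
  + apply: sqnorm_bij (_ : bijective (twist n)) _ _ B'E.
    by exists (twist n^-1%g) => w; rewrite /twist !mulgA invgK;
      rewrite ?(mulgV, mulVg, mul1g, mulgK, mulgVK).
(* [twist n z] is a conjugate of z * g^-1 under K, multiplied on the right by g. *)
- move=> z zg fin; apply: (icc (z * g^-1)%g).
    by move=> z1; case/eqP: zg; rewrite -(mulgVK g z) z1 mul1g.
  apply: (@sub_finite_set _ _ [set (w * g^-1)%g | w in [set phi z | phi in [set twist n | n in K]]]).
    move=> _ [n Kn <-]; exists (twist n z); first by exists (twist n) => //; exists n.
    by rewrite /twist !mulgA mulgK.
  exact: finite_image.
(* S commutes with B, so the commutator entry expressed by c is 0. *)
- move=> u [B [PB -> _]]; rewrite cA; [|exact: bP|exact: eP].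
  rewrite -[S (B _)]/((S \o B) _) cS // subrr //.
Qed.
End GroupVonNeumann.

(** * Maximality of the subalgebra *)

Theorem theoremC (R : realType) (N Q A : groupType) (sigma : action N Q) :
  ~ elementary Q ->
  torsion_free Q ->
  lacunary_hyperbolic R Q ->
  property_T R Q ->
  rank_one A ->
  nontrivial A ->
  (forall M : set Q, maximal_subgroup M -> subgroup_isomorphic M A) ->
  Rip_T R sigma ->
  forall Qm : set Q, maximal_subgroup Qm ->
    maximal_von_neumann_subalgebra ell2_dot
      (group_vN R (sdprod_over sigma Qm))
      (group_vN R [set: sdprod sigma]%classic).
Proof.
move=> nelem _ _ _ _ _ _ [[_ [_ [_ rh] tf [inj _]]] _] Qm [sQm nQm maxQm].
(* In a finite group the trivial subgroup is cyclic of finite index, with all elements as coset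
   representatives. *)
have infQ : ~ finite_set [set: Q].
  move=> fQ; apply: nelem; exists 1%g, setT => // q; exists q => //.
  by rewrite mulVg => S [[]].
have [Q1 QM QV] := sQm.
have sH : subgroup (sdprod_over sigma Qm).
  by split=> [|x y|x]; [exact: Q1|exact: QM|exact: QV].
have sT : subgroup [set: sdprod sigma] by [].
have vH := group_vN_von_neumann (R := R) sH.
split=> //; [exact: group_vN_von_neumann|exact: group_vNS|].
move=> [P [vP [HP nPH] [PG nGP]]].
pose K : set (sdprod sigma) := [set sdprod_inl sigma n | n in [set: N]].
have translation B g : P B -> B (delta 1%g) g <> 0 -> P (left_regular g).
  apply: (intermediate_translation (K := K) _ _ _ vP HP PG).
  - by move=> _ [n _ <-]; exists n^-1%g => //; rewrite sdprod_inlV.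
  (* Conjugates of elements of N project to the identity of Q, which lies in [Qm]. *)
  - move=> x _ [n _ <-]; rewrite /sdprod_over /= mulg1 mulVg.
    exact: Q1.
  - move=> x x1 fin; apply: x1; apply: (normal_class_infinite infQ tf rh inj).
    apply: sub_finite_set fin => _ [n _ <-].
    by exists (sdprod_inl sigma n) => //; exists n.
(* The intermediate subgroup to which maximality of [Qm] will apply. *)
pose L : set Q := [set q | P (left_regular (sdprod_inr sigma q))].
have PHt h : sdprod_over sigma Qm h -> P (left_regular h).
  by move=> Hh; apply/HP/group_vN_translation.
(* The translation by the N-part of g is already in [P], so only the Q-part matters. *)
have LE g : P (left_regular g) <-> L g.2.
  have gE : g = (sdprod_inl sigma g.1 * sdprod_inr sigma g.2)%g.
    by rewrite sdprod_mulE /= act1 mulg1 mul1g -surjective_pairing.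
  have Pl n : P (left_regular (sdprod_inl sigma n)) by apply: PHt; exact: Q1.
  split=> Pg.
    have : P (left_regular ((sdprod_inl sigma g.1)^-1 * g)%g).
      rewrite left_regularM; apply: von_neumann_comp => //.
      exact: von_neumann_translationV.
    by rewrite {2}gE mulKg.
  by rewrite gE left_regularM; apply: von_neumann_comp.
have sL : subgroup L.
  split=> [|x y Lx Ly|x Lx].
  - by apply: PHt; exact: Q1.
  - apply/(LE (sdprod_inr sigma x * sdprod_inr sigma y)%g).
    by rewrite left_regularM; apply: von_neumann_comp.
  - apply/(LE (sdprod_inr sigma x)^-1%g).
    exact: von_neumann_translationV.
have QmL : Qm `<=` L by move=> q Qq; apply: PHt.
(* If [L] is [Qm], all elements of [P] have Fourier support over [Qm], so [P] is the smaller
   algebra. If [L] is all of Q, then [P] contains every translation and is the larger one. *)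
have [LQm|LT] := maxQm L sL QmL.
  apply: nPH => B PB; apply: group_vN_support; first exact: PG.
  move=> g nHg; apply: contrapT => Bg; apply: nHg.
  rewrite /sdprod_over /= -LQm; apply: (LE g).1; exact: translation Bg.
apply: nGP; apply: group_vN_min => // g _; apply: (LE g).2.
by rewrite LT.
Qed.
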